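(* Let $H$ be a closed subgroup of $G$ whose annihilator $A$ is at most countable, let $x\in G\setminus H$ and $S=x+H$. Let $\mu_0,\mu_n\in\mathcal M$ $(n\in\mathbb N)$ with $\lim_{n\to\infty}\|\mu_0-\mu_n\|=0$. (i) $\lim_{n\to\infty}d_2(\mu_n;S)=d_2(\mu_0;S)$. (ii) If $\operatorname{card}A=2$, then $\lim_{n\to\infty}d_p(\mu_n;S)=d_p(\mu_0;S)$ for all $p\in(1,\infty)$. (iii) If $\mu_0\ll\mu_n$ for all $n\in\mathbb N$, then $\lim_{n\to\infty}\int|\phi_{\mu_0,2}(S)-\phi_{\mu_n,2}(S)|^2\,d\mu_0=0$. (iv) If $\operatorname{card}A=2$ and $\mu_0\ll\mu_n$ for all $n\in\mathbb N$, then $\lim_{n\to\infty}\int|\phi_{\mu_0,p}(S)-\phi_{\mu_n,p}(S)|^p\,d\mu_0=0$ for all $p\in(1,\infty)$.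
   Context: $G$ is a locally compact abelian Hausdorff group (written additively), $\Gamma$ is its dual group, and for $x\in G$, $e_x:\Gamma\to\mathbb C$ denotes the character of $\Gamma$ generated by $x$. The annihilator of a closed subgroup $H$ of $G$ is $A:=\{\gamma\in\Gamma:e_y(\gamma)=1\text{ for all }y\in H\}$. $\mathcal M$ is the set of all non-zero finite non-negative regular Borel measures on $\Gamma$, and $\|\cdot\|$ is the total variation norm. For a non-empty set $S\subseteq G\setminus\{0\}$, $\mathcal T(S)$ is the complex linear space of all finite sums $\sum_j a_je_{x_j}$ with $a_j\in\mathbb C$, $x_j\in S$. For $\mu\in\mathcal M$ and $p\in(1,\infty)$, $d_p(\mu;S):=\inf\{\int|1-\tau|^p\,d\mu:\tau\in\mathcal T(S)\}$, and the metric projection $\phi_{\mu,p}(S)$ is the unique element of the closure of $\mathcal T(S)$ in $L^p(\mu)$ with $\int|1-\phi_{\mu,p}(S)|^p\,d\mu=d_p(\mu;S)$. *)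

(* Defs.v *)
From HB Require Import structures.
From mathcomp Require Import all_boot all_order all_algebra.
From mathcomp Require Import all_classical all_reals all_analysis.
From mathcomp Require Import complex.

Set Implicit Arguments.
Unset Strict Implicit.
Unset Printing Implicit Defensive.

Import Order.TTheory GRing.Theory Num.Theory.
Import numFieldNormedType.Exports.

Local Open Scope classical_set_scope.
Local Open Scope ring_scope.
Local Open Scope complex_scope.

(* The usual topology of the complex field, i.e. the one given by its modulus. *)
HB.instance Definition _ (R : realType) :=
  NormedModule.copy R[i] (R[i] : numClosedFieldType).

Section dual_group.
Variables (R : realType) (G : topologicalZmodType).

Definition is_character : set {compact-open, G -> R[i]} :=
  [set chi : G -> R[i] | [/\ continuous chi, forall x, `|chi x| = 1 &
    {morph chi : x y / x + y >-> x * y}]].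

Definition dual : Type := set_type is_character.
HB.instance Definition _ := Topological.on dual.

Lemma dualP (chi : dual) : is_character (\val chi).
Proof. by case: chi => chi /= /set_mem. Qed.

Definition dual_of chi (chiP : is_character chi) : dual :=
  exist _ chi (mem_set chiP).

Lemma is_character1 : is_character (fun=> 1).
Proof.
by split=> [x|x|x y]; [exact: cvg_cst|rewrite normr1|rewrite mulr1].
Qed.

Lemma is_characterM (chi psi : dual) :
  is_character (fun x => \val chi x * \val psi x).
Proof.
have [c1 n1 m1] := dualP chi; have [c2 n2 m2] := dualP psi; split.
- by move=> x; exact: (@cvgM _ _ _ _ _ _ _ _ (c1 x) (c2 x)).
- by move=> x; rewrite normrM n1 n2 mulr1.
- by move=> x y; rewrite m1 m2 mulrACA.
Qed.

Lemma is_characterV (chi : dual) : is_character (fun x => (\val chi x)^-1).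
Proof.
have [c1 n1 m1] := dualP chi; split.
- move=> x; apply: (@cvgV _ _ _ _ _ _ _ (c1 x)).
  by rewrite -normr_eq0 n1 oner_eq0.
- by move=> x; rewrite normfV n1 invr1.
- by move=> x y; rewrite m1 invfM.
Qed.

(* The dual group is written additively. *)
Let dual0 := dual_of is_character1.
Let dualD (chi psi : dual) := dual_of (is_characterM chi psi).
Let dualN (chi : dual) := dual_of (is_characterV chi).

Let dualA : associative dualD.
Proof.
by move=> a b c; apply: val_inj; apply/funext => x /=; rewrite mulrA.
Qed.
Let dualC : commutative dualD.
Proof.
by move=> a b; apply: val_inj; apply/funext => x /=; rewrite mulrC.
Qed.
Let dual0d : left_id dual0 dualD.
Proof. by move=> a; apply: val_inj; apply/funext => x /=; rewrite mul1r. Qed.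
Let dualNd : left_inverse dual0 dualN dualD.
Proof.
move=> a; apply: val_inj; apply/funext => x /=; rewrite mulVf//.
by have [_ n1 _] := dualP a; rewrite -normr_eq0 n1 oner_eq0.
Qed.
HB.instance Definition _ := GRing.isZmodule.Build dual dualA dualC dual0d dualNd.
HB.instance Definition _ := isPointed.Build dual 0.

(* The dual group with its Borel sigma-algebra. *)
Definition borel_dual := g_sigma_algebraType (@open dual).

(* The character of the dual group generated by x. *)
Definition e_ (x : G) (gamma : borel_dual) : R[i] := \val (gamma : dual) x.

Definition annihilator (H : set G) : set dual :=
  [set gamma | forall y, H y -> e_ y gamma = 1].

Definition trig_poly (S : set G) : set (borel_dual -> R[i]) :=
  [set tau | exists n (a : 'I_n -> R[i]) (x : 'I_n -> G),
    (forall j, S (x j)) /\ tau = fun gamma => \sum_(j < n) a j * e_ (x j) gamma].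

Definition regular_measure (mu : set borel_dual -> \bar R) : Prop :=
  forall B : set borel_dual, measurable B ->
    mu B = ereal_inf [set mu U | U in [set U : set dual | open U /\ B `<=` U]] /\
    mu B = ereal_sup [set mu K | K in [set K : set dual | compact K /\ K `<=` B]].

Definition calM : set {finite_measure set borel_dual -> \bar R} :=
  [set mu | mu setT != 0%E /\ regular_measure mu].

End dual_group.

Arguments annihilator R {G} H.

Section Lp.
Context {d : measure_display} {T : measurableType d} {R : realType}.
Implicit Types (mu : {measure set T -> \bar R}) (p : R) (f : T -> R[i]).

(* The integral of |f|^p, for a complex-valued f. *)
Definition int_powp mu p f : \bar R :=
  (\int[mu]_t ((ComplexField.Normc.normc (f t)) `^ p)%:E)%E.

Definition Lp mu p : set (T -> R[i]) :=
  [set f : T -> R[i] | [/\ measurable_fun setT (@complex.Re R \o f),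
    measurable_fun setT (@complex.Im R \o f) & (int_powp mu p f < +oo)%E]].

(* The closure of F in L^p(mu). *)
Definition Lp_closure mu p (F : set (T -> R[i])) : set (T -> R[i]) :=
  [set f : T -> R[i] | Lp mu p f /\
    forall e : R, 0 < e -> exists2 g, F g & (int_powp mu p (f \- g)%R < e%:E)%E].

(* The variation does not depend on the choice of the Hahn decomposition. *)
Definition total_variation (nu : {charge set T -> \bar R}) : \bar R :=
  let PN := cid (Hahn_decomposition nu) in
  charge_variation (svalP (cid (svalP PN))) setT.

Definition tv_dist (mu nu : {finite_measure set T -> \bar R}) : \bar R :=
  total_variation (cadd (charge_of_finite_measure mu)
                        (copp (charge_of_finite_measure nu))).

End Lp.

Section projection.
Variables (R : realType) (G : topologicalZmodType).
Implicit Types (mu : {measure set (borel_dual R G) -> \bar R}) (p : R).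

Definition dist_p mu p (S : set G) : \bar R :=
  ereal_inf [set int_powp mu p (cst 1 \- tau) | tau in trig_poly S].

(* Elements of L^p are represented by functions; the metric projection, which
   is unique up to mu-null sets, is a chosen representative. *)
Definition metric_projection mu p (S : set G) : borel_dual R G -> R[i] :=
  get [set phi | Lp_closure mu p (trig_poly S) phi /\
                 int_powp mu p (cst 1 \- phi) = dist_p mu p S].

End projection.

(* Main.v *)
Require Import Defs.
From HB Require Import structures.
From mathcomp Require Import all_boot all_order all_algebra.
From mathcomp Require Import all_classical all_reals all_analysis.
From mathcomp Require Import complex.
From mathcomp Require Import ring lra measurable_realfun.

Set Implicit Arguments.
Unset Strict Implicit.
Unset Printing Implicit Defensive.

Import Order.TTheory GRing.Theory Num.Theory.
Import numFieldNormedType.Exports.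

Local Open Scope classical_set_scope.
Local Open Scope ring_scope.

Local Notation normc := ComplexField.Normc.normc.

(** Since H is a subgroup, the trigonometric polynomials with frequencies in H
    form an algebra closed under complex conjugation, and T(x + H) is e_x times
    that algebra.  Hence tau * r(|tau|^2) lies in T(S) for every tau in T(S) and
    every real polynomial r.  The radial retraction z |-> z / max(1, |z|) of the
    plane onto the unit disc is z * rho(|z|^2) with rho continuous, and it takes
    no point further away from any point of the disc.  Approximating rho by Bernstein
    polynomials, each tau can be exchanged for an element of T(S) that is bounded
    by 2 and is, up to an arbitrarily small error, nowhere further from a given
    point of the disc than tau was ([disc_retract_dense],
    [trig_poly_coset_trunc]).

    The constant function 1 takes its value in the disc, so the infimum d_p may be
    taken over functions bounded by 2 ([bounded_near_minimizer]).  For those the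
    integrand |1 - tau|^p is at most 3^p, and therefore
    |d_p(mu) - d_p(nu)| <= 3^p ||mu - nu|| ([dist_tv_dist]): this is the continuity
    of the distance.

    For the projections, uniform convexity of z |-> |z|^p, proved by compactness
    and homogeneity ([normc_powR_unif_convex]) and then integrated
    ([near_minimizers_close]), makes near-minimizers close to each other in
    L^p(mu).  It gives the existence of the projection as the limit of a fast
    Cauchy sequence of bounded near-minimizers ([exists_projection]).  Now let
    mu_0 << nu, and let g_k be bounded near-minimizers for nu that converge to
    phi_nu fast enough to converge nu-almost everywhere.  The convergence also
    holds mu_0-almost everywhere, so by dominated convergence phi_nu is a limit of
    the g_k in L^p(mu_0) as well ([projection_approx]).  When nu is close to mu_0 in
    total variation, such a g_k is also a near-minimizer for mu_0, hence close to
    phi_{mu_0} in L^p(mu_0), and so is phi_nu ([projection_cvg]). *)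

(** * The modulus of a complex number *)

Lemma normc_ge0 (R : rcfType) (z : R[i]) : 0 <= normc z.
Proof. by case: z => a b; exact: sqrtr_ge0. Qed.

Lemma normcD (R : rcfType) (z w : R[i]) : normc (z + w) <= normc z + normc w.
Proof. exact: (@le_normcD R z w). Qed.

Lemma normcB_sym (R : rcfType) (z w : R[i]) : normc (z - w) = normc (w - z).
Proof. by rewrite -opprB; exact: (@normcN R (w - z)). Qed.

Lemma normc_tri (R : rcfType) (a b c : R[i]) : normc (a - c) <= normc (a - b) + normc (b - c).
Proof. by have := normcD (a - b) (b - c); rewrite addrA subrK. Qed.

Lemma normc_real (R : rcfType) (a : R) : normc (a%:C)%C = `|a|.
Proof. by rewrite /normc/= expr0n/= addr0 sqrtr_sqr. Qed.

Lemma normc_sq (R : rcfType) (z : R[i]) :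
  normc z ^+ 2 = complex.Re z ^+ 2 + complex.Im z ^+ 2.
Proof. by case: z => a b /=; rewrite sqr_sqrtr// addr_ge0// sqr_ge0. Qed.

Lemma normc_half (R : rcfType) (z : R[i]) : normc (z / 2) = normc z / 2.
Proof.
rewrite ComplexField.Normc.normcM; congr (_ * _).
have -> : 2^-1 = (2^-1 : R)%:C%C :> R[i] by rewrite fmorphV/= rmorph_nat.
by rewrite normc_real ger0_norm// invr_ge0.
Qed.

Lemma le_Re_normc (R : rcfType) (z : R[i]) : `|complex.Re z| <= normc z.
Proof. by case: z => a b /=; rewrite -sqrtr_sqr ler_wsqrtr// lerDl sqr_ge0. Qed.

Lemma le_Im_normc (R : rcfType) (z : R[i]) : `|complex.Im z| <= normc z.
Proof. by case: z => a b /=; rewrite -sqrtr_sqr ler_wsqrtr// lerDr sqr_ge0. Qed.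

Lemma normc_parallelogram (R : rcfType) (z w : R[i]) :
  normc (z + w) ^+ 2 + normc (z - w) ^+ 2 = 2 * (normc z ^+ 2 + normc w ^+ 2).
Proof. by rewrite !normc_sq; case: z => a b; case: w => c d /=; ring. Qed.

(** * Convexity of powers of the modulus *)

(** For r = e^y > 0 this is a combination, with positive coefficients, of the strict
    inequalities 1 + u < e^u at u = (p - 1) y and at u = - y. *)
Lemma powR_gt_tangent (R : realType) (p r : R) : 1 < p -> 0 <= r -> r != 1 ->
  1 + p * (r - 1) < r `^ p.
Proof.
move=> p1; rewrite le_eqVlt => /predU1P[<- _|r0 r1].
  by rewrite powR0 ?gt_eqF// ?(lt_trans ltr01)//; lra.
have y0 : ln r != 0.
  by rewrite ln_eq0.
have e1 := @expR_gt1Dx R ((p - 1) * ln r).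
have e2 := @expR_gt1Dx R (- ln r).
rewrite oppr_eq0 in e2; rewrite mulf_eq0 negb_or y0 subr_eq0 (gt_eqF p1)/= in e1.
have {}e1 := e1 isT; have {}e2 := e2 y0.
have -> : r `^ p = r * expR ((p - 1) * ln r).
  rewrite /powR gt_eqF//= mulrBl mul1r expRD expRN lnK ?posrE//.
  by rewrite mulrCA mulfV ?mulr1 ?gt_eqF.
rewrite expRN lnK ?posrE// in e2.
have {}e2 : r * (1 - ln r) < 1 by rewrite -ltr_pdivlMl// mulr1.
have {e1} : r * (1 + (p - 1) * ln r) < r * expR ((p - 1) * ln r) by rewrite ltr_pM2l.
apply: le_lt_trans.
have : (p - 1) * (r * (1 - ln r)) < (p - 1) * 1 by rewrite ltr_pM2l// subr_gt0.
lra.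
Qed.

Lemma powR_midpoint_lt (R : realType) (p a b : R) : 1 < p ->
  0 <= a -> 0 <= b -> a != b -> ((a + b) / 2) `^ p < (a `^ p + b `^ p) / 2.
Proof.
move=> p1 a0 b0 ab; have [c cE] : exists c, c = (a + b) / 2 by eexists.
rewrite -cE.
have c0 : 0 < c.
  rewrite cE divr_gt0// lt_neqAle addr_ge0// andbT eq_sym paddr_eq0//.
  by apply: contra ab => /andP[/eqP-> /eqP->].
have tgt : forall x, 0 <= x -> x != c ->
    c `^ p * (1 + p * (x / c - 1)) < x `^ p.
  move=> x x0 xc; rewrite -{2}(divfK (lt0r_neq0 c0) x).
  rewrite [X in _ < X]powRM ?divr_ge0// 1?ltW//.
  rewrite mulrC ltr_pM2r ?powR_gt0//; apply: powR_gt_tangent => //.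
    by rewrite divr_ge0// ltW.
  by apply: contra xc => /eqP xc; rewrite -(divfK (lt0r_neq0 c0) x) xc mul1r.
have ac : a != c by apply: contra ab => /eqP ac; apply/eqP; move: ac; rewrite cE; lra.
have bc : b != c by apply: contra ab => /eqP bc; apply/eqP; move: bc; rewrite cE; lra.
have := ltrD (tgt a a0 ac) (tgt b b0 bc).
rewrite -mulrDr.
have bE : b / c = 2 - a / c.
  by rewrite (_ : b = 2 * c - a) ?mulrBl ?mulfK ?gt_eqF// cE; field.
have -> : 1 + p * (a / c - 1) + (1 + p * (b / c - 1)) = 2 by rewrite bE; ring.
by move=> h; rewrite ltr_pdivlMr.
Qed.

Lemma powR_convex (R : realType) (p w a b : R) : 1 <= p -> 0 <= w <= 1 ->
  0 <= a -> 0 <= b ->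
  (w * a + (1 - w) * b) `^ p <= w * a `^ p + (1 - w) * b `^ p.
Proof.
move=> p1 /andP[w0 w1] a0 b0.
have := @convex_powR R p p1 (Itv01 w0 w1) a b.
by rewrite !inE/= !in_itv/= !andbT !convRE/= /unstable.onem; apply.
Qed.

(** Apply the convexity of the power to a + b = w (a / w) + (1 - w) (b / (1 - w)),
    with w < 1 chosen so that the first coefficient w^(1 - p) equals 1 + eta.
    A perturbation b thus costs only a factor close to 1 on the main term a. *)
Lemma powRD_le (R : realType) (p eta : R) : 1 < p -> 0 < eta ->
  exists2 C : R, 0 <= C & forall a b : R, 0 <= a -> 0 <= b ->
    (a + b) `^ p <= (1 + eta) * a `^ p + C * b `^ p.
Proof.
move=> p1 eta0; pose w := (1 + eta) `^ (- (p - 1)^-1).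
have eta1 : 0 < 1 + eta by rewrite addr_gt0.
have w0 : 0 < w by rewrite powR_gt0.
have w1 : w < 1.
  rewrite /w powRN invf_lt1 ?powR_gt0//.
  have q0 : 0 < (p - 1)^-1 by rewrite invr_gt0 subr_gt0.
  have := @gt0_ltr_powR R _ q0 1 (1 + eta).
  by rewrite !nnegrE ler01 (ltW eta1) ltrDl powR1; apply.
have wE : w * w `^ (- p) = 1 + eta.
  rewrite -{1}(powRr1 (ltW w0)) -powRD; last by rewrite (gt_eqF w0) implybT.
  rewrite /w -powRrM (_ : _ * _ = 1) ?powRr1 ?ltW//.
  by field; rewrite subr_eq0 gt_eqF.
have v0 : 0 < 1 - w by rewrite subr_gt0.
exists ((1 - w) * (1 - w) `^ (- p)); first by rewrite mulr_ge0 ?powR_ge0// ltW.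
move=> a b a0 b0; rewrite -wE.
have w01 : 0 <= w <= 1 by rewrite !ltW.
have aw0 : 0 <= a / w by rewrite divr_ge0// ltW.
have bw0 : 0 <= b / (1 - w) by rewrite divr_ge0// ltW.
have := powR_convex (ltW p1) w01 aw0 bw0.
have divpE x y : 0 <= x -> 0 < y -> y * (x / y) `^ p = y * y `^ (- p) * x `^ p.
  move=> x0 y0; have yi0 : 0 <= y^-1 by rewrite invr_ge0 ltW.
  rewrite (powRM _ x0 yi0) -[y^-1]powR_inv1; last exact: ltW.
  rewrite -powRrM mulN1r.
  by rewrite -mulrA [x `^ p * _]mulrC.
by rewrite mulrC divfK ?gt_eqF// [_ * (b / _)]mulrC divfK ?gt_eqF// !divpE.
Qed.

(** If the moduli differ, the strictness comes from the power function on the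
    half-line; if they agree, it comes from the parallelogram law. *)
Lemma normc_powR_midpoint_lt (R : realType) (p : R) (z w : R[i]) : 1 < p ->
  z != w -> normc ((z + w) / 2) `^ p < (normc z `^ p + normc w `^ p) / 2.
Proof.
move=> p1 zw; have p0 : 0 < p by rewrite (lt_trans ltr01).
have [zwE|zwN] := eqVneq (normc z) (normc w).
  rewrite zwE (_ : (_ + _) / 2 = normc w `^ p); last by field.
  apply: gt0_ltr_powR; rewrite ?nnegrE ?normc_ge0//.
  rewrite -ltr_sqr ?nnegrE ?normc_ge0// normc_half expr_div_n.
  have d0 : 0 < normc (z - w) ^+ 2.
    rewrite exprn_gt0// lt_neqAle normc_ge0 andbT eq_sym.
    by apply: contra zw => /eqP/ComplexField.Normc.eq0_normc/eqP; rewrite subr_eq0.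
  have := normc_parallelogram z w; rewrite zwE.
  by lra.
apply: le_lt_trans (powR_midpoint_lt p1 (normc_ge0 _) (normc_ge0 _) zwN).
rewrite normc_half ge0_ler_powR ?nnegrE ?(ltW p0)//.
- by rewrite divr_ge0// normc_ge0.
- by rewrite divr_ge0// addr_ge0// normc_ge0.
- by rewrite ler_pM2r ?invr_gt0// normcD.
Qed.

Lemma continuous_norm_powR (R : realType) (p : R) : 0 < p ->
  continuous (fun x : R => `|x| `^ p).
Proof.
move=> p0 x; have [->|x0] := eqVneq x 0.
  rewrite /continuous_at normr0 powR0 ?gt_eqF//; apply/cvgrPdist_lt => e e0.
  near=> y; rewrite sub0r normrN ger0_norm ?powR_ge0//.
  rewrite -[ltRHS](powRr1 (ltW e0)) -(mulVf (lt0r_neq0 p0)) powRrM.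
  apply: gt0_ltr_powR; rewrite ?nnegrE ?powR_ge0//.
  near: y; apply: (cvgr0_norm_lt id) => //; exact: powR_gt0.
apply: (@cvg_trans _ ((fun y => expR (p * ln `|y|)) @ x)).
  apply: near_eq_cvg; near=> y; rewrite /powR normr_eq0 ifF//.
  apply/negbTE; near: y.
  exact: open_neq.
rewrite (_ : `|x| `^ p = expR (p * ln `|x|)); last by rewrite /powR normr_eq0 (negbTE x0).
have cl : {for x, continuous ((@ln R) \o (fun y => `|y|))}.
  apply: continuous_comp; first exact: norm_continuous.
  by apply: continuous_ln; rewrite normr_gt0.
have cpl : {for x, continuous (fun y => p * ln `|y|)}.
  by apply: cvgM; [exact: cvg_cst|exact: cl].
exact: (continuous_comp cpl (@continuous_expR R _)).
Unshelve. all: by end_near. Qed.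

Lemma continuous_normc_powR (R : realType) (p : R) (T : topologicalType)
  (f g : T -> R) : 0 < p -> continuous f -> continuous g ->
  continuous (fun t => normc (f t +i* g t)%C `^ p).
Proof.
move=> p0 cf cg t.
have cs : {for t, continuous (fun t => f t ^+ 2 + g t ^+ 2)}.
  by apply: cvgD; apply: cvgM; (exact: cf || exact: cg).
have c2 := continuous_comp cs (@sqrt_continuous R _).
have := @continuous_comp _ _ _ _ (fun x : R => `|x| `^ p) _ c2 (@continuous_norm_powR _ _ p0 _).
rewrite (_ : _ \o _ = fun t => normc (f t +i* g t)%C `^ p)//.
by apply/funext => u /=; rewrite ger0_norm ?sqrtr_ge0.
Qed.

Lemma closed_le_fun (R : realType) (T : topologicalType) (f g : T -> R) :
  continuous f -> continuous g -> closed [set t | f t <= g t].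
Proof.
move=> cf cg; rewrite (_ : [set _ | _] = (fun t => g t - f t) @^-1` [set x | 0 <= x]).
  by apply: preimage_closed; [move=> t _; apply: cvgB; [exact: cg|exact: cf]|exact: closed_ge].
by apply/seteqP; split => t /=; rewrite subr_ge0.
Qed.

(** The gap Delta in the midpoint inequality is positive and continuous on the
    compact set of pairs in the unit disc with |z - w|^p >= e, so it is bounded
    below there; homogeneity extends the resulting inequality to all pairs.  In
    this form, linear in p-th powers, the inequality can be integrated. *)
Lemma normc_powR_unif_convex (R : realType) (p e : R) : 1 < p -> 0 < e ->
  exists2 C : R, 0 <= C & forall z w : R[i],
    normc (z - w) `^ p + C * normc ((z + w) / 2) `^ p <=
      (e + C / 2) * (normc z `^ p + normc w `^ p).
Proof.
move=> p1 e0; have p0 : 0 < p by rewrite (lt_trans ltr01).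
pose U := ((R * R) * (R * R))%type.
pose zz (u : U) : R[i] := (u.1.1 +i* u.1.2)%C.
pose ww (u : U) : R[i] := (u.2.1 +i* u.2.2)%C.
pose Delta (z w : R[i]) :=
  (normc z `^ p + normc w `^ p) / 2 - normc ((z + w) / 2) `^ p.
have Delta_ge0 z w : 0 <= Delta z w.
  rewrite /Delta subr_ge0; have [->|zw] := eqVneq z w; last first.
    by rewrite ltW// normc_powR_midpoint_lt.
  rewrite (_ : (w + w) / 2 = w); last by field.
  by rewrite le_eqVlt (_ : _ / 2 = normc w `^ p) ?eqxx//; field.
have c11 : continuous (fun u : U => u.1.1).
  by move=> u; apply: continuous_comp; exact: cvg_fst.
have c12 : continuous (fun u : U => u.1.2).
  by move=> u; apply: continuous_comp; [exact: cvg_fst|exact: cvg_snd].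
have c21 : continuous (fun u : U => u.2.1).
  by move=> u; apply: continuous_comp; [exact: cvg_snd|exact: cvg_fst].
have c22 : continuous (fun u : U => u.2.2).
  by move=> u; apply: continuous_comp; [exact: cvg_snd|exact: cvg_snd].
have cz : continuous (fun u : U => normc (zz u) `^ p) by exact: continuous_normc_powR.
have cw : continuous (fun u : U => normc (ww u) `^ p) by exact: continuous_normc_powR.
have cd : continuous (fun u : U => normc (zz u - ww u) `^ p).
  apply: (@continuous_normc_powR _ _ _ (fun u : U => u.1.1 - u.2.1)
    (fun u : U => u.1.2 - u.2.2)) => // u; apply: cvgB;
    by [exact: c11|exact: c21|exact: c12|exact: c22].
have cm : continuous (fun u : U => normc ((zz u + ww u) / 2) `^ p).
  rewrite (_ : (fun u => _) = (fun u : U => normc (((u.1.1 + u.2.1) / 2)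
      +i* ((u.1.2 + u.2.2) / 2))%C `^ p)).
    apply: continuous_normc_powR => // u; apply: cvgM; try exact: cvg_cst;
    apply: cvgD; by [exact: c11|exact: c21|exact: c12|exact: c22].
  apply/funext => u; congr (normc _ `^ _).
  have -> : 2^-1 = (2^-1 : R)%:C%C :> R[i] by rewrite fmorphV/= rmorph_nat.
  by rewrite /zz /ww; simpc.
have cDelta : continuous (fun u : U => Delta (zz u) (ww u)).
  move=> u; apply: cvgB; last exact: cm.
  by apply: cvgM; [apply: cvgD; [exact: cz|exact: cw]|exact: cvg_cst].
pose box : set U := (`[-1, 1]%classic `*` `[-1, 1]%classic) `*`
  (`[-1, 1]%classic `*` `[-1, 1]%classic).
pose K := box `&` [set u | e <= normc (zz u - ww u) `^ p].
have cK : compact K.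
  apply: compact_closedI.
    by apply: compact_setX; apply: compact_setX; exact: segment_compact.
  by apply: closed_le_fun => // u; exact: cvg_cst.
have [m m0 mD] : exists2 m : R, 0 < m & forall u, K u -> m <= Delta (zz u) (ww u).
  have [->|/set0P K0] := eqVneq K set0; first by exists 1.
  have [u + umin] := compact_EVT_min K0 cK (continuous_subspaceT cDelta).
  rewrite inE => -[_ ue]; exists (Delta (zz u) (ww u)).
    rewrite subr_gt0 normc_powR_midpoint_lt//; apply/eqP => zw.
    have : e <= normc (zz u - ww u) `^ p := ue.
    rewrite zw subrr ComplexField.Normc.normc0 powR0 ?gt_eqF//.
    by rewrite leNgt e0.
  by move=> v Kv; apply: umin; rewrite inE.
(* On K, |z - w|^p <= 2^p = C m <= C Delta. *)
pose C := 2 `^ p / m.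
have C0 : 0 <= C by rewrite divr_ge0 ?powR_ge0// ltW.
exists C => // z w.
have unit_case (z' w' : R[i]) : normc z' <= 1 -> normc w' <= 1 ->
    normc (z' - w') `^ p <= e + C * Delta z' w'.
  move=> z1 w1; have [ze|/ltW ze] := leP e (normc (z' - w') `^ p); last first.
    by rewrite (le_trans ze)// lerDl mulr_ge0.
  rewrite (@le_trans _ _ (2 `^ p))//.
    apply: ge0_ler_powR; rewrite ?nnegrE ?normc_ge0 ?(ltW p0)//.
    have := normcD z' (- w').
    have -> : normc (- w') = normc w' by exact: (@normcN R w').
    by lra.
  rewrite (@le_trans _ _ (C * m))//; first by rewrite /C divfK ?gt_eqF.
  rewrite (@le_trans _ _ (C * Delta z' w'))//; last by rewrite lerDr ltW.
  have coord (v : R[i]) : normc v <= 1 ->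
     ([/\ -1 <= complex.Re v <= 1 & -1 <= complex.Im v <= 1]).
    move=> v1; have : normc v ^+ 2 <= 1 by rewrite exprn_ile1 ?normc_ge0.
    rewrite normc_sq => h; split; rewrite -ler_norml;
      rewrite -(@ler_pXn2r _ 2) ?nnegrE// expr1n real_normK ?num_real//.
      by have := sqr_ge0 (complex.Im v); lra.
    by have := sqr_ge0 (complex.Re v); lra.
  have [za zb] := coord _ z1; have [wa wb] := coord _ w1.
  have := mD ((complex.Re z', complex.Im z'), (complex.Re w', complex.Im w')).
  rewrite /zz /ww /=; move: za zb wa wb ze {z1 w1}.
  case: z' => a b; case: w' => c d /= za zb wa wb ze h.
  rewrite ler_wpM2l//; apply: h; split => //.
(* Rescale by the larger modulus s to land in the unit disc. *)
pose s := Num.max (normc z) (normc w).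
have zs : normc z <= s by rewrite le_max lexx.
have ws : normc w <= s by rewrite le_max lexx orbT.
have s0 : 0 <= s := le_trans (normc_ge0 z) zs.
have sp : s `^ p <= normc z `^ p + normc w `^ p.
  by rewrite /s /Num.max; case: ifP => _; rewrite ?(lerDl, lerDr) powR_ge0.
suff : normc (z - w) `^ p <= e * s `^ p + C * Delta z w.
  have : e * s `^ p <= e * (normc z `^ p + normc w `^ p) by rewrite ler_wpM2l// ltW.
  rewrite /Delta; lra.
move: s0; rewrite le_eqVlt => /predU1P[s0|s0].
  have z0 : z = 0 by apply/ComplexField.Normc.eq0_normc/le_anti; rewrite normc_ge0 s0 zs.
  have w0 : w = 0 by apply/ComplexField.Normc.eq0_normc/le_anti; rewrite normc_ge0 s0 ws.
  rewrite z0 w0 subrr ComplexField.Normc.normc0 powR0 ?gt_eqF//.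
  by rewrite addr_ge0// mulr_ge0 ?powR_ge0 ?Delta_ge0 ?(ltW e0).
have scale (v : R[i]) : normc v `^ p = s `^ p * normc (v / s%:C%C) `^ p.
  rewrite ComplexField.Normc.normcM ComplexField.Normc.normcV normc_real gtr0_norm//.
  by rewrite -powRM ?divr_ge0 ?normc_ge0 ?(ltW s0)// mulrC divfK ?gt_eqF.
have scale1 (v : R[i]) : normc v <= s -> normc (v / s%:C%C) <= 1.
  rewrite ComplexField.Normc.normcM ComplexField.Normc.normcV normc_real gtr0_norm// => vs.
  by rewrite ler_pdivrMr// mul1r.
have := unit_case _ _ (scale1 _ zs) (scale1 _ ws).
rewrite -(ler_pM2l (powR_gt0 p s0)) -mulrBl -scale => /le_trans; apply.
rewrite mulrDr [s `^ p * e]mulrC lerD2l mulrCA ler_wpM2l//.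
rewrite /Delta (scale z) (scale w) (scale ((z + w) / 2)) mulrBr lerB//.
  by rewrite mulrA mulrDr.
by rewrite mulrAC mulrDl.
Qed.

(** * Retraction onto the unit disc by polynomials *)

(** The Bernstein polynomial with nodes phi 0, ..., phi n, evaluated at s by
    Pascal's rule.  In this form it visibly stays in any algebra containing s, and
    its moments are computed by induction on n. *)
Fixpoint bernstein (R : pzRingType) (n : nat) (phi : nat -> R) (s : R) : R :=
  if n is m.+1 then
    s * bernstein m (fun k => phi k.+1) s + (1 - s) * bernstein m phi s
  else phi 0%N.

(** Mean n s and variance n s (1 - s) of the binomial distribution, packed in the
    form in which they bound a function by a parabola. *)
Lemma bernstein_quadratic (R : comPzRingType) n (a b c s : R) :
  bernstein n (fun k => a + b * (k%:R - c) ^+ 2) s =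
  a + b * (n%:R * s * (1 - s) + (n%:R * s - c) ^+ 2).
Proof.
elim: n c => [|n IHn] c /=; first by ring.
rewrite IHn (_ : (fun k => _) = (fun k => a + b * (k%:R - (c - 1)) ^+ 2)).
  by rewrite IHn; ring.
by apply/funext => k; ring.
Qed.

Lemma le_bernstein (R : numDomainType) n (phi psi : nat -> R) (s : R) :
  0 <= s <= 1 -> (forall k, (k <= n)%N -> phi k <= psi k) ->
  bernstein n phi s <= bernstein n psi s.
Proof.
move=> /andP[s0 s1]; elim: n phi psi => [|n IHn] phi psi le_phi /=; first exact: le_phi.
rewrite lerD// ler_wpM2l ?subr_ge0//; apply: IHn => k kn; apply: le_phi => //.
exact: leqW.
Qed.

(** By L |u| <= e / 2 + (L u)^2 / (2 e), a Lipschitz function lies within a parabola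
    around s whose Bernstein polynomial is known exactly. *)
Lemma bernstein_approx (R : archiRealFieldType) (f : R -> R) (L e : R) : 0 < e ->
  (forall s t : R, 0 <= s <= 1 -> 0 <= t <= 1 -> `|f s - f t| <= L * `|s - t|) ->
  exists n, forall s : R, 0 <= s <= 1 ->
    `|bernstein n (fun k => f (k%:R / n%:R)) s - f s| <= e.
Proof.
move=> e0 lipf; pose n := (Num.truncn (L ^+ 2 / e ^+ 2)).+1.
have n0 : 0 < n%:R :> R by rewrite ltr0n.
have nL : L ^+ 2 / e ^+ 2 <= n%:R by rewrite ltW// truncnS_gt.
exists n => s s01; have /andP[s0 s1] := s01.
pose b := L ^+ 2 / (2 * e * n%:R ^+ 2).
have b0 : 0 <= b by rewrite divr_ge0 ?sqr_ge0// !mulr_ge0 ?sqr_ge0// ltW.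
have dev k : (k <= n)%N -> `|f (k%:R / n%:R) - f s| <= e / 2 + b * (k%:R - n%:R * s) ^+ 2.
  move=> kn; have k01 : 0 <= (k%:R / n%:R : R) <= 1.
    by rewrite divr_ge0//= ler_pdivrMr// mul1r ler_nat.
  apply: (le_trans (lipf _ _ k01 s01)).
  set u := k%:R / n%:R - s; have -> : k%:R - n%:R * s = n%:R * u.
    by rewrite /u mulrBr mulrCA mulfV ?mulr1// gt_eqF.
  have -> : b * (n%:R * u) ^+ 2 = (L * `|u|) ^+ 2 / e / 2.
    by rewrite /b !exprMn real_normK ?num_real//; field; rewrite !gt_eqF.
  have := sqr_ge0 (L * `|u| - e); set v := L * `|u|.
  move=> h; rewrite -(ler_pM2r e0).
  have -> : (e / 2 + v ^+ 2 / e / 2) * e = (e ^+ 2 + v ^+ 2) / 2.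
    by field; rewrite gt_eqF.
  by move: h; lra.
have quad := bernstein_quadratic n _ _ (n%:R * s) s.
have var_le : b * (n%:R * s * (1 - s) + (n%:R * s - n%:R * s) ^+ 2) <= e / 2.
  rewrite subrr expr0n/= addr0 /b.
  have ss : s * (1 - s) <= 1.
    by have := sqr_ge0 s; rewrite expr2; nra.
  rewrite (@le_trans _ _ (L ^+ 2 / (2 * e * n%:R ^+ 2) * n%:R))//.
    by rewrite ler_wpM2l// -mulrA ler_piMr// ltW.
  have -> : L ^+ 2 / (2 * e * n%:R ^+ 2) * n%:R = (L ^+ 2 / e ^+ 2) * (e / (2 * n%:R)).
    by field; rewrite !gt_eqF.
  have -> : e / 2 = n%:R * (e / (2 * n%:R)) by field; rewrite gt_eqF.
  by rewrite ler_wpM2r// divr_ge0 ?mulr_ge0// ltW.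
rewrite ler_distl; apply/andP; split.
  apply: (@le_trans _ _ (bernstein n
      (fun k => (f s - e / 2) + (- b) * (k%:R - n%:R * s) ^+ 2) s)).
    by rewrite quad mulNr; move: var_le; lra.
  by apply: le_bernstein => // k /dev; rewrite ler_distl => /andP[]; lra.
apply: (@le_trans _ _ (bernstein n
    (fun k => (f s + e / 2) + b * (k%:R - n%:R * s) ^+ 2) s)).
  by apply: le_bernstein => // k /dev; rewrite ler_distl => /andP[]; lra.
by rewrite quad; move: var_le; lra.
Qed.

(** The radial factor of the retraction: shrink (|z|^2) = 1 / max(1, |z|).  It is a
    function of |z|^2 because |f|^2, unlike |f|, is a trigonometric polynomial when
    f is. *)
Definition shrink (R : rcfType) (t : R) : R := (Num.sqrt (Num.max 1 t))^-1.

Lemma shrink_lipschitz (R : rcfType) (s t : R) : `|shrink s - shrink t| <= `|s - t|.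
Proof.
have sqrt1 (x : R) : 1 <= Num.sqrt (Num.max 1 x).
  by rewrite -[leLHS]sqrtr1 ler_wsqrtr// le_max lexx.
have sqrE (x : R) : Num.sqrt (Num.max 1 x) ^+ 2 = Num.max 1 x.
  by rewrite sqr_sqrtr// le_max ler01.
rewrite /shrink; move: (sqrt1 s) (sqrt1 t) (sqrE s) (sqrE t).
set u := Num.sqrt _; set v := Num.sqrt (Num.max 1 t) => u1 v1 uE vE.
have u0 := lt_le_trans ltr01 u1; have v0 := lt_le_trans ltr01 v1.
have -> : u^-1 - v^-1 = (v - u) / (u * v) by field; rewrite !gt_eqF.
rewrite normrM normfV (ger0_norm (mulr_ge0 (ltW u0) (ltW v0))).
rewrite (@le_trans _ _ `|v - u|)//.
  by rewrite ler_pdivrMr ?mulr_gt0// ler_peMr// mulr_ege1.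
rewrite (@le_trans _ _ (`|v - u| * (v + u)))//.
  by rewrite ler_peMr//; lra.
have vu0 : 0 <= v + u by rewrite addr_ge0 ?ltW.
have -> : `|v - u| * (v + u) = `|v ^+ 2 - u ^+ 2|.
  by rewrite subr_sqr normrM (ger0_norm vu0).
rewrite uE vE distrC.
by rewrite /Num.max; case: ifP; case: ifP => h1 h2; rewrite ?subrr ?normr0//;
  [rewrite !ger0_norm; lra|rewrite distrC [leRHS]distrC !ger0_norm; lra].
Qed.

Lemma shrink_sq (R : rcfType) (c : R) : 0 <= c ->
  shrink (c ^+ 2) = (Num.max 1 c)^-1.
Proof.
move=> c0; congr (_^-1); rewrite /Num.max.
have -> : (1 < c ^+ 2) = (1 < c) by rewrite expr_gt1.
by case: ifP; rewrite ?sqrtr1// sqrtr_sqr ger0_norm.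
Qed.

Definition disc_retract (R : rcfType) (z : R[i]) : R[i] :=
  z * (shrink (normc z ^+ 2))%:C%C.

Lemma normc_disc_retract (R : rcfType) (z : R[i]) : normc (disc_retract z) <= 1.
Proof.
rewrite ComplexField.Normc.normcM normc_real shrink_sq ?normc_ge0//.
have m1 : 1 <= Num.max 1 (normc z) by rewrite le_max lexx.
have m0 := lt_le_trans ltr01 m1.
by rewrite gtr0_norm ?invr_gt0// ler_pdivrMr// mul1r le_max lexx orbT.
Qed.

(** Along the ray of z = c zeta with |zeta| = 1 < c, the squared distance to w
    decreases by (c - 1) (c + 1 - 2 <zeta, w>) from c zeta to zeta. *)
Lemma disc_retract_dist (R : rcfType) (z w : R[i]) : normc w <= 1 ->
  normc (disc_retract z - w) <= normc (z - w).
Proof.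
move=> w1; rewrite /disc_retract shrink_sq ?normc_ge0//.
rewrite /Num.max; case: ifPn => [c1|_]; last by rewrite invr1 mulr1.
set c := normc z in c1 *; pose zeta := z * (c^-1)%:C%C.
have c0 : 0 < c by rewrite (lt_trans ltr01).
have zE : z = c%:C%C * zeta.
  by rewrite /zeta mulrCA -rmorphM/= mulfV ?gt_eqF// mulr1.
have zeta1 : normc zeta = 1.
  by rewrite ComplexField.Normc.normcM normc_real ger0_norm ?invr_ge0 ?ltW// mulfV// gt_eqF.
rewrite -/zeta [in leRHS]zE -(@ler_pXn2r _ 2) ?nnegrE ?normc_ge0// !normc_sq.
have : normc w ^+ 2 <= 1 by rewrite exprn_ile1 ?normc_ge0.
have : normc zeta ^+ 2 = 1 by rewrite zeta1 expr1n.
rewrite !normc_sq; move: zeta {zE zeta1} => [a b] {w1}; case: w => u v /=.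
rewrite !mul0r subr0 addr0 => ab uv.
have q1 : a * u + b * v <= 1.
  have := sqr_ge0 (a - u); have := sqr_ge0 (b - v); nra.
have : 0 <= (c - 1) * (c + 1 - 2 * (a * u + b * v)) by apply: mulr_ge0; lra.
have : c ^+ 2 * (a ^+ 2 + b ^+ 2) = c ^+ 2 by rewrite ab mulr1.
move: ab; nra.
Qed.

(** If r is a Bernstein polynomial of shrink, f * r(|f|^2) is uniformly close to the
    retraction of f.  In the application A is the algebra of trigonometric polynomials with
    frequencies in a subgroup, and F the A-module of those with frequencies in a
    coset. *)
Lemma disc_retract_dense (R : realType) (T : Type) (A F : set (T -> R[i])) :
  (forall c : R, A (fun=> c%:C%C)) ->
  (forall f g, A f -> A g -> A (fun t => f t + g t)) ->
  (forall f g, A f -> A g -> A (fun t => f t * g t)) ->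
  (forall f a, F f -> A a -> F (fun t => f t * a t)) ->
  (forall f, F f -> A (fun t => (normc (f t) ^+ 2)%:C%C)) ->
  forall f (M e : R), F f -> (forall t, normc (f t) <= M) -> 0 < e ->
  exists2 g, F g & forall t, normc (g t) <= 2 /\
    forall w, normc w <= 1 -> normc (g t - w) <= normc (f t - w) + e.
Proof.
move=> Ac AD AM FA FF f M e Ff fM e0.
pose B := Num.max 1 (M ^+ 2).
have B1 : 1 <= B by rewrite le_max lexx.
have B0 := lt_le_trans ltr01 B1.
pose d := Num.min 1 e / B.
have me0 : 0 < Num.min 1 e by rewrite lt_min ltr01.
have d0 : 0 < d by rewrite divr_gt0.
have lip (s t : R) : 0 <= s <= 1 -> 0 <= t <= 1 ->
    `|shrink (B * s) - shrink (B * t)| <= B * `|s - t|.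
  move=> _ _; apply: (le_trans (shrink_lipschitz _ _)).
  by rewrite -mulrBr normrM gtr0_norm.
have [n approx] := bernstein_approx d0 lip.
set phi := fun k : nat => _ in approx.
pose s t := normc (f t) ^+ 2 / B.
have s01 t : 0 <= s t <= 1.
  apply/andP; split; first by apply: divr_ge0; [exact: sqr_ge0|exact: ltW].
  rewrite /s ler_pdivrMr// mul1r le_max; apply/orP; right.
  by rewrite ler_pXn2r ?nnegrE ?normc_ge0// (le_trans _ (fM t)) ?normc_ge0.
have As : A (fun t => (s t)%:C%C).
  have -> : (fun t => (s t)%:C%C) =
      (fun t => (normc (f t) ^+ 2)%:C%C * (B^-1)%:C%C) :> (T -> R[i]).
    by apply/funext => t; rewrite -rmorphM.
  by apply: AM; [exact: FF|exact: Ac].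
have A1s : A (fun t => (1 - s t)%:C%C).
  have -> : (fun t => (1 - s t)%:C%C) =
      (fun t => 1%:C%C + (-1)%:C%C * (s t)%:C%C) :> (T -> R[i]).
    by apply/funext => t; rewrite -rmorphM -rmorphD/= mulN1r.
  by apply: AD; [exact: Ac|apply: AM => //; exact: Ac].
have Abern m psi : A (fun t => (bernstein m psi (s t))%:C%C).
  elim: m psi => [|m IHm] psi; first exact: Ac.
  have -> : (fun t => (bernstein m.+1 psi (s t))%:C%C) = (fun t =>
      (s t)%:C%C * (bernstein m (fun k => psi k.+1) (s t))%:C%C +
      (1 - s t)%:C%C * (bernstein m psi (s t))%:C%C) :> (T -> R[i]).
    by apply/funext => t; rewrite -!rmorphM -rmorphD.
  by apply: AD; exact: AM.
exists (fun t => f t * (bernstein n phi (s t))%:C%C); first exact: FA.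
move=> t; set g := f t * _.
have gr : normc (g - disc_retract (f t)) <= Num.min 1 e.
  rewrite /g /disc_retract -mulrBr -rmorphB/= ComplexField.Normc.normcM normc_real.
  have ft : normc (f t) <= B.
    rewrite le_max; apply/orP; have [c1|/ltW c1] := leP (normc (f t)) 1; first by left.
    right; apply: (@le_trans _ _ (normc (f t) ^+ 2)).
      by rewrite expr2 ler_peMr ?normc_ge0.
    by rewrite ler_pXn2r ?nnegrE ?normc_ge0// (le_trans _ (fM t)) ?normc_ge0.
  have := approx _ (s01 t); rewrite {2}/s mulrCA mulfV ?gt_eqF// mulr1 => ap.
  rewrite (_ : Num.min 1 e = B * d); last by rewrite /d mulrC divfK// gt_eqF.
  by apply: ler_pM; rewrite ?normc_ge0.
split=> [|w w1].
  have := normcD (g - disc_retract (f t)) (disc_retract (f t)); rewrite subrK.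
  have := normc_disc_retract (f t).
  have : Num.min 1 e <= 1 by rewrite ge_min lexx.
  by move: gr; lra.
have := normcD (g - disc_retract (f t)) (disc_retract (f t) - w).
rewrite addrA subrK; have := disc_retract_dist (f t) w1.
have : Num.min 1 e <= e by rewrite ge_min lexx orbT.
by move: gr; lra.
Qed.

(** * Integrals of p-th powers *)

Section integrals.
Context {d : measure_display} {T : measurableType d} {R : realType}.
Implicit Types (mu nu : {measure set T -> \bar R}) (p : R) (f g h : T -> R[i]).

Definition cmeasurable f :=
  measurable_fun setT (@complex.Re R \o f) /\
  measurable_fun setT (@complex.Im R \o f).

Lemma cmeasurable_cst (c : R[i]) : cmeasurable (cst c).
Proof. by split; exact: measurable_cst. Qed.

Lemma cmeasurableD f g : cmeasurable f -> cmeasurable g ->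
  cmeasurable (fun t => f t + g t).
Proof.
move=> [fr fi] [gr gi]; split.
- rewrite (_ : _ \o _ = (@complex.Re R \o f) \+ (@complex.Re R \o g)).
    exact: measurable_funD.
  by apply/funext => t /=; rewrite raddfD.
- rewrite (_ : _ \o _ = (@complex.Im R \o f) \+ (@complex.Im R \o g)).
    exact: measurable_funD.
  by apply/funext => t /=; rewrite raddfD.
Qed.

Lemma cmeasurableM f g : cmeasurable f -> cmeasurable g ->
  cmeasurable (fun t => f t * g t).
Proof.
move=> [fr fi] [gr gi]; split.
- rewrite (_ : _ \o _ = ((@complex.Re R \o f) \* (@complex.Re R \o g)) \-
    ((@complex.Im R \o f) \* (@complex.Im R \o g))).
    by apply: measurable_funB; exact: measurable_funM.
  by apply/funext => t /=; case: (f t) => a b; case: (g t).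
- rewrite (_ : _ \o _ = ((@complex.Re R \o f) \* (@complex.Im R \o g)) \+
    ((@complex.Im R \o f) \* (@complex.Re R \o g))).
    by apply: measurable_funD; exact: measurable_funM.
  by apply/funext => t /=; case: (f t) => a b; case: (g t).
Qed.

Lemma cmeasurableB f g : cmeasurable f -> cmeasurable g -> cmeasurable (f \- g).
Proof.
move=> mf mg.
rewrite (_ : f \- g = fun t => f t + (cst (-1) t) * g t).
  by apply: cmeasurableD => //; apply: cmeasurableM => //; exact: cmeasurable_cst.
by apply/funext => t /=; rewrite mulN1r.
Qed.

Lemma measurable_normc_powR p f : cmeasurable f ->
  measurable_fun setT (fun t => normc (f t) `^ p).
Proof.
move=> [fr fi].
rewrite (_ : (fun t => _) = (@powR R ^~ p) \o ((@Num.sqrt R) \o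
  (((@complex.Re R \o f) \* (@complex.Re R \o f)) \+
    ((@complex.Im R \o f) \* (@complex.Im R \o f))))); last first.
  by apply/funext => t /=; case: (f t) => a b.
apply: (measurableT_comp (measurable_powR p)).
apply: (measurableT_comp (continuous_measurable_fun (@sqrt_continuous R))).
by apply: measurable_funD; exact: measurable_funM.
Qed.

Lemma measurable_normc_powR_EFin p f : cmeasurable f ->
  measurable_fun setT (fun t => (normc (f t) `^ p)%:E).
Proof. by move=> mf; apply/measurable_EFinP; exact: measurable_normc_powR. Qed.

Lemma int_powp_ge0 mu p f : (0 <= int_powp mu p f)%E.
Proof. by apply: integral_ge0 => t _; rewrite lee_fin powR_ge0. Qed.

Lemma integral_lin_powR mu p (a b : R) f g : 0 <= a -> 0 <= b ->
  cmeasurable f -> cmeasurable g ->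
  (\int[mu]_t (a * normc (f t) `^ p + b * normc (g t) `^ p)%:E =
   a%:E * int_powp mu p f + b%:E * int_powp mu p g)%E.
Proof.
move=> a0 b0 mf mg.
under eq_integral do rewrite EFinD !EFinM.
rewrite ge0_integralD//=.
- rewrite !ge0_integralZl_EFin//; try exact: measurable_normc_powR_EFin;
  by move=> t _; rewrite lee_fin powR_ge0.
- by move=> t _; rewrite lee_fin mulr_ge0 ?powR_ge0.
- by apply: emeasurable_funM => //; exact: measurable_normc_powR_EFin.
- by move=> t _; rewrite lee_fin mulr_ge0 ?powR_ge0.
- by apply: emeasurable_funM => //; exact: measurable_normc_powR_EFin.
Qed.

(** Two terms on each side accommodate both the triangle-type inequality
    [powRD_le] and the uniform convexity inequality. *)
Lemma le_int_powp_lin mu p (a b c e : R) f g h k :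
  0 <= a -> 0 <= b -> 0 <= c -> 0 <= e ->
  cmeasurable f -> cmeasurable g -> cmeasurable h -> cmeasurable k ->
  (forall t, a * normc (f t) `^ p + b * normc (g t) `^ p <=
             c * normc (h t) `^ p + e * normc (k t) `^ p) ->
  (a%:E * int_powp mu p f + b%:E * int_powp mu p g <=
   c%:E * int_powp mu p h + e%:E * int_powp mu p k)%E.
Proof.
move=> a0 b0 c0 e0 mf mg mh mk le_fghk.
rewrite -(integral_lin_powR mu p a0 b0 mf mg) -(integral_lin_powR mu p c0 e0 mh mk).
apply: ge0_le_integral => //.
- by move=> t _; rewrite lee_fin addr_ge0 ?mulr_ge0 ?powR_ge0.
- apply/measurable_EFinP; apply: measurable_funD; apply: measurable_funM => //;
  exact: measurable_normc_powR.
- apply/measurable_EFinP; apply: measurable_funD; apply: measurable_funM => //;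
  exact: measurable_normc_powR.
- by move=> t _; rewrite lee_fin.
Qed.

Lemma int_powp_bounded (mu : {finite_measure set T -> \bar R}) p f (M : R) :
  0 <= p -> cmeasurable f -> (forall t, normc (f t) <= M) ->
  (int_powp mu p f <= (M `^ p)%:E * mu setT)%E.
Proof.
move=> p0 mf fM; rewrite -(integral_cst mu measurableT); apply: ge0_le_integral => //.
- by move=> t _; rewrite lee_fin powR_ge0.
- exact: measurable_normc_powR_EFin.
- move=> t _; rewrite lee_fin ge0_ler_powR ?nnegrE ?normc_ge0//.
  exact: le_trans (normc_ge0 _) (fM t).
Qed.

Lemma int_powp_sym mu p f g : int_powp mu p (f \- g) = int_powp mu p (g \- f).
Proof. by apply: eq_integral => t _ /=; rewrite normcB_sym. Qed.

Lemma tv_distE (mu nu : {finite_measure set T -> \bar R}) :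
  exists (xi : {charge set T -> \bar R}) P N (PN : hahn_decomposition xi P N),
    (forall A, xi A = mu A - nu A)%E /\ tv_dist mu nu = charge_variation PN setT.
Proof. by do 4 eexists; split; last reflexivity. Qed.

(** If xi^+ and xi^- are the Jordan parts of mu - nu, then mu + xi^- = nu + xi^+, and
    both parts have total mass at most ||mu - nu||. *)
Lemma le_integral_tv_dist (mu nu : {finite_measure set T -> \bar R})
    (f : T -> R) (M : R) : measurable_fun setT f -> (forall t, 0 <= f t <= M) ->
  (\int[mu]_t (f t)%:E <= \int[nu]_t (f t)%:E + M%:E * tv_dist mu nu /\
   \int[nu]_t (f t)%:E <= \int[mu]_t (f t)%:E + M%:E * tv_dist mu nu)%E.
Proof.
move=> mf fM; have [xi [P [N [PN [xiE ->]]]]] := tv_distE mu nu.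
set jp := jordan_pos PN; set jn := jordan_neg PN.
have mfE : measurable_fun setT (EFin \o f) by exact/measurable_EFinP.
have f0 t : setT t -> (0%:E <= (EFin \o f) t)%E.
  by move=> _; rewrite lee_fin; case/andP: (fM t).
have sub_add (a b c e : \bar R) : a \is a fin_num -> b \is a fin_num ->
    c \is a fin_num -> e \is a fin_num -> (a - b = c - e -> a + e = b + c)%E.
  case: a b c e => [a| |] [b| |] [c| |] [e| |] // _ _ _ _.
  by rewrite -!EFinN -!EFinD => -[h]; congr EFin; lra.
have bal : (\int[mu]_t (f t)%:E + \int[jn]_t (f t)%:E =
            \int[nu]_t (f t)%:E + \int[jp]_t (f t)%:E)%E.
  rewrite -!(ge0_integral_measure_add _ _ _ f0 mfE)//.
  apply: eq_measure_integral => A mA _.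
  rewrite -[LHS]/(measure_add mu jn A) -[RHS]/(measure_add nu jp A) !measure_addE.
  have : (mu A - nu A = jp A - jn A)%E.
    rewrite -xiE (jordan_decomp PN mA); congr (_ + _)%E.
    exact: mulN1e.
  by apply: sub_add; exact: fin_num_measure.
have M0 : 0 <= M by case/andP: (fM point) => /le_trans h; exact: h.
have bnd (m : {measure set T -> \bar R}) : (\int[m]_t (f t)%:E <= M%:E * m setT)%E.
  rewrite -integral_cst//; apply: ge0_le_integral => // t _.
  by rewrite lee_fin; case/andP: (fM t).
have i0 (m : {measure set T -> \bar R}) : (0 <= \int[m]_t (f t)%:E)%E by exact: integral_ge0.
rewrite /charge_variation ge0_muleDr//.
split.
  apply: (@le_trans _ _ (\int[mu]_t (f t)%:E + \int[jn]_t (f t)%:E)%E).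
    by rewrite leeDl//; exact: i0.
  rewrite bal leeD2l//; apply: (le_trans (bnd jp)).
  by rewrite leeDl// mule_ge0.
apply: (@le_trans _ _ (\int[nu]_t (f t)%:E + \int[jp]_t (f t)%:E)%E).
  by rewrite leeDl//; exact: i0.
rewrite -bal leeD2l//; apply: (le_trans (bnd jn)).
by rewrite leeDr// mule_ge0.
Qed.

(** The sum of the h_k is integrable, hence finite almost everywhere. *)
Lemma ae_cvg0_of_small_integrals mu (h : nat -> T -> R) :
  (forall k, measurable_fun setT (h k)) -> (forall k t, 0 <= h k t) ->
  (forall k, (\int[mu]_t (h k t)%:E <= (2^-1 ^+ k)%:E)%E) ->
  {ae mu, forall t, h ^~ t @ \oo --> (0 : R)}.
Proof.
move=> mh h0 small; pose S t := (\sum_(k <oo) (h k t)%:E)%E.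
have mS : measurable_fun setT S.
  apply: ge0_emeasurable_sum => [k t _ _|k _]; first by rewrite lee_fin.
  exact/measurable_EFinP.
have S0 t : (0 <= S t)%E by apply: nneseries_ge0 => k _ _; rewrite lee_fin.
have iS : mu.-integrable setT S.
  apply/integrableP; split => //.
  under eq_integral do rewrite gee0_abs//.
  rewrite integral_nneseries//.
  - apply: (@le_lt_trans _ _ (\sum_(k <oo) (2^-1 ^+ k)%:E)%E).
      apply: lee_nneseries => [k _ _|k _]; last exact: small.
      by apply: integral_ge0 => t _; rewrite lee_fin.
    rewrite (_ : (fun n : nat => _) = EFin \o series (geometric 1 2^-1)); last first.
      apply/funext => n /=; rewrite sumEFin; congr (_%:E).
      by apply: eq_bigr => k _ /=; rewrite mul1r.
    have h2 : `|2^-1 : R| < 1 by rewrite ger0_norm// invf_lt1// ltr1n.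
    by rewrite EFin_lim ?ltry//; exact: is_cvg_geometric_series.
  - by move=> k; exact/measurable_EFinP.
  - by move=> k t _; rewrite lee_fin.
apply: filterS (integrable_ae measurableT iS) => t /(_ I) St.
apply: cvg_series_cvg_0; apply: nondecreasing_is_cvgn.
  by apply/nondecreasing_seqP => n; rewrite /series/= big_nat_recr//= lerDl.
exists (fine (S t)) => _ [n _ <-]; rewrite -lee_fin fineK//.
rewrite /series/= -sumEFin.
by apply: nneseries_lim_ge => k _ _; rewrite lee_fin.
Qed.

End integrals.

(** * Bounded sequences in L^p *)

Lemma fast_cauchy_cvg (R : realType) (u : R^nat) (N : nat) :
  (forall k, (N <= k)%N -> `|u k.+1 - u k| <= 2^-1 ^+ k) -> cvgn u.
Proof.
move=> fast; pose w k := u (k + N)%N.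
have cs : cvgn (series (telescope w)).
  apply: normed_cvg; apply: (@series_le_cvg _ _ (geometric 1 2^-1)) => [k|k|k|].
  - exact: normr_ge0.
  - by rewrite /= mulr_ge0.
  - rewrite /telescope /w /= addSn mul1r (le_trans (fast _ (leq_addl _ _)))//.
    by rewrite exprD ler_piMr// exprn_ile1// invf_le1 ?ler1n.
  - by apply: is_cvg_geometric_series; rewrite ger0_norm// invf_lt1// ltr1n.
have /cvg_ex[/= l wl] := cs.
apply/cvg_ex; exists (u N + l); rewrite -(cvg_shiftn N).
rewrite (_ : [sequence _]_n = (fun n => u N + series (telescope w) n)).
  by apply: cvgD => //; exact: cvg_cst.
by apply/funext => n; rewrite [LHS](eq_sum_telescope w).
Qed.

Lemma powR_lt1 (R : realType) (p c : R) : 0 < p -> 0 <= c -> c `^ p < 1 -> c <= 1.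
Proof.
move=> p0 c0; apply: contraTT; rewrite -ltNge -leNgt => c1.
rewrite -[leLHS](_ : 1 `^ p = 1); last by rewrite powR1.
by apply: ge0_ler_powR; rewrite ?nnegrE// ltW.
Qed.

Section bounded_sequences.
Context {d : measure_display} {T : measurableType d} {R : realType}.
Variables (p : R) (p0 : 0 < p) (M : R) (g : nat -> T -> R[i]).
Hypotheses (mg : forall k, cmeasurable (g k)) (gM : forall k t, normc (g k t) <= M).
Implicit Types (mu : {finite_measure set T -> \bar R}) (phi : T -> R[i]).

(** Dominated convergence: where g_k converges to phi, |phi| <= M + 1 since some
    |g_k - phi| is at most 1. *)
Lemma bounded_cvg_int_powp mu phi : cmeasurable phi ->
  {ae mu, forall t, normc (g k t - phi t) `^ p @[k --> \oo] --> (0 : R)} ->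
  int_powp mu p (g k \- phi) @[k --> \oo] --> 0%E.
Proof.
move=> mphi ae_cvg.
have bounded (t : T) : normc (g k t - phi t) `^ p @[k --> \oo] --> (0 : R) ->
    forall n, normc (g n t - phi t) `^ p <= (2 * M + 1) `^ p.
  move=> /cvgrPdist_lt/(_ _ ltr01)[k _ /(_ k (leqnn k))] /=.
  rewrite sub0r normrN ger0_norm ?powR_ge0// => /(powR_lt1 p0 (normc_ge0 _)) gk n.
  have M0 : 0 <= M := le_trans (normc_ge0 (g k t)) (gM k t).
  apply: ge0_ler_powR; rewrite ?nnegrE ?normc_ge0 ?(ltW p0) ?addr_ge0 ?mulr_ge0//.
  have -> : g n t - phi t = (g n t - g k t) + (g k t - phi t) by rewrite addrA subrK.
  apply: (le_trans (normcD _ _)); rewrite lerD//.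
  apply: (le_trans (normcD _ _)); rewrite -[- g k t]sub0r normcB_sym subr0.
  by rewrite mulr_natl mulr2n lerD.
pose f k t := (normc (g k t - phi t) `^ p)%:E.
have f0 : {ae mu, forall t, setT t -> f k t @[k --> \oo] --> (cst 0%E : T -> \bar R) t}.
  by apply: filterS ae_cvg => t ct _; apply: cvg_EFin => //; exact: nearW.
have fM : {ae mu, forall t n, setT t ->
    (`|f n t| <= (EFin \o cst ((2 * M + 1) `^ p)%R) t)%E}.
  apply: filterS ae_cvg => t ct n _.
  by rewrite /f gee0_abs ?lee_fin ?powR_ge0//=; exact: bounded.
have mf k : measurable_fun setT (f k).
  exact: (measurable_normc_powR_EFin p (cmeasurableB (mg k) mphi)).
have [_ _] := dominated_convergence measurableT mf (measurable_cst _) f0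
  (finite_measure_integrable_cst mu _ measurableT) fM.
by rewrite integral0; apply.
Qed.

Lemma ae_cvg_int_powp mu (h : nat -> T -> R[i]) : (forall k, cmeasurable (h k)) ->
  (forall k, int_powp mu p (h k) <= (2^-1 ^+ k)%:E)%E ->
  {ae mu, forall t, normc (h k t) `^ p @[k --> \oo] --> (0 : R)}.
Proof.
move=> mh small; apply: ae_cvg0_of_small_integrals => // [k|k t].
  exact: measurable_normc_powR.
exact: powR_ge0.
Qed.

(** Completeness of L^p, restricted to uniformly bounded sequences so that
    dominated convergence applies.  The functions h_k = 2^k (g_(k+1) - g_k) tend to
    0 almost everywhere, so almost everywhere |g_(k+1) - g_k| <= 2^-k from some k
    on. *)
Lemma bounded_fast_cauchy mu :
  (forall k, int_powp mu p (g k.+1 \- g k)%R <= ((2^-1 ^+ k) `^ p * 2^-1 ^+ k)%:E)%E ->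
  exists2 phi, cmeasurable phi & int_powp mu p (g k \- phi) @[k --> \oo] --> 0%E.
Proof.
move=> fast.
pose h k t := (2 ^+ k)%:C%C * (g k.+1 t - g k t).
have hE k t : normc (h k t) = 2 ^+ k * normc (g k.+1 t - g k t).
  by rewrite /h ComplexField.Normc.normcM normc_real ger0_norm ?exprn_ge0.
have mh k : cmeasurable (h k).
  apply: cmeasurableM; first exact: cmeasurable_cst.
  exact: (cmeasurableB (mg k.+1) (mg k)).
have small k : (int_powp mu p (h k) <= (2^-1 ^+ k)%:E)%E.
  have -> : int_powp mu p (h k) = (((2 ^+ k) `^ p)%:E * int_powp mu p (g k.+1 \- g k)%R)%E.
    rewrite -ge0_integralZl_EFin ?powR_ge0//.
    - by apply: eq_integral => t _; rewrite hE powRM ?exprn_ge0 ?normc_ge0.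
    - by move=> t _; rewrite lee_fin powR_ge0.
    - exact: (measurable_normc_powR_EFin p (cmeasurableB (mg k.+1) (mg k))).
  apply: (le_trans (lee_wpmul2l _ (fast k))); first by rewrite lee_fin powR_ge0.
  rewrite -EFinM lee_fin mulrA -powRM ?exprn_ge0// -exprMn mulfV//.
  by rewrite expr1n powR1 mul1r.
have [Z [mZ Z0 Zcvg]] := ae_cvg_int_powp mh small.
have cvg_part (part : R[i] -> R) : (forall z w, part (z - w) = part z - part w) ->
    (forall z, `|part z| <= normc z) -> forall t, ~ Z t ->
    cvgn (fun k => part (g k t)).
  move=> partB le_part t tZ.
  have : normc (h k t) `^ p @[k --> \oo] --> (0 : R).
    by apply: contrapT => ncvg; apply: tZ; apply: Zcvg.
  move=> /cvgrPdist_lt/(_ _ ltr01)[N _ hN].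
  apply: (@fast_cauchy_cvg _ _ N) => k Nk; rewrite -partB (le_trans (le_part _))//.
  have := hN k Nk; rewrite /= sub0r normrN ger0_norm ?powR_ge0//.
  move=> /(powR_lt1 p0 (normc_ge0 _)); rewrite hE.
  by rewrite -ler_pdivlMl ?exprn_gt0// mulr1 exprVn.
(* On the null set Z the limit is set to 0, so as to be measurable. *)
pose ind : T -> R := \1_(~` Z).
have mind : measurable_fun setT ind by apply: measurable_indic; exact: measurableC.
have lim_part (part : R[i] -> R) : (forall z w, part (z - w) = part z - part w) ->
    (forall z, `|part z| <= normc z) -> (forall k, measurable_fun setT (part \o g k)) ->
    exists2 l : T -> R, measurable_fun setT l &
      forall t, ~ Z t -> part (g k t) @[k --> \oo] --> l t.
  move=> partB le_part mpart.
  exists (fun t => limn (fun k => part (g k t)) * ind t); last first.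
    move=> t tZ; rewrite /ind indicE in_setC memNset// mulr1.
    exact: cvg_part.
  apply: (@measurable_fun_cvg _ _ _ _ (fun k t => part (g k t) * ind t)) => [k|t _].
    exact: (measurable_funM (mpart k) mind).
  rewrite /ind indicE; have [tZ|tZ] := pselect (Z t).
    by rewrite in_setC mem_set// mulr0; under eq_fun do rewrite mulr0; exact: cvg_cst.
  by apply: cvgM; [exact: cvg_part|exact: cvg_cst].
have [|||a ma acvg] := lim_part (@complex.Re R).
- by move=> z w; rewrite raddfB.
- exact: le_Re_normc.
- by move=> k; case: (mg k).
have [|||b mb bcvg] := lim_part (@complex.Im R).
- by move=> z w; rewrite raddfB.
- exact: le_Im_normc.
- by move=> k; case: (mg k).
exists (fun t => (a t +i* b t)%C); first by split.
apply: bounded_cvg_int_powp; first by split.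
exists Z; split => // t /= ncvg; apply: contrapT => tZ; apply: ncvg.
have ca : (complex.Re (g k t) - a t) @[k --> \oo] --> (0 : R).
  by rewrite -(subrr (a t)); apply: cvgB; [exact: acvg|exact: cvg_cst].
have cb : (complex.Im (g k t) - b t) @[k --> \oo] --> (0 : R).
  by rewrite -(subrr (b t)); apply: cvgB; [exact: bcvg|exact: cvg_cst].
have cs : Num.sqrt ((complex.Re (g k t) - a t) ^+ 2 + (complex.Im (g k t) - b t) ^+ 2)
    @[k --> \oo] --> (0 : R).
  rewrite -[X in _ --> X]sqrtr0.
  apply: (@continuous_cvg _ _ _ _ _ _ (@Num.sqrt R)); first exact: sqrt_continuous.
  rewrite -[X in _ --> X](_ : (0 : R) * 0 + 0 * 0 = 0); last by rewrite mulr0 addr0.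
  by apply: cvgD; apply: cvgM.
have := @continuous_cvg _ _ _ _ _ _ (fun x : R => `|x| `^ p) _ (@continuous_norm_powR _ _ p0 0) cs.
rewrite normr0 powR0 ?gt_eqF// => cp; apply: cvg_trans; last exact: cp.
apply: near_eq_cvg; apply: nearW => k /=.
by rewrite ger0_norm ?sqrtr_ge0//; case: (g k t).
Qed.

End bounded_sequences.

Section perturbation.
Context {d : measure_display} {T : measurableType d} {R : realType}.
Variables (p : R) (p1 : 1 < p).

Lemma int_powpD_le (eta : R) : 0 < eta -> exists2 C : R, 0 <= C &
  forall (mu : {measure set T -> \bar R}) (f g h : T -> R[i]),
  cmeasurable f -> cmeasurable g -> cmeasurable h ->
  (forall t, normc (h t) <= normc (f t) + normc (g t)) ->
  (int_powp mu p h <= (1 + eta)%:E * int_powp mu p f + C%:E * int_powp mu p g)%E.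
Proof.
move=> eta0; have p0 : 0 < p by rewrite (lt_trans ltr01).
have [C C0 powC] := powRD_le p1 eta0.
exists C => // mu f g h mf mg mh hfg.
have := @le_int_powp_lin _ _ _ mu p 1 0 (1 + eta) C h h f g ler01 (lexx _)
  (addr_ge0 ler01 (ltW eta0)) C0 mh mh mf mg.
rewrite mul1e mul0e adde0; apply=> t.
rewrite mul1r mul0r addr0 (le_trans _ (powC _ _ _ _)) ?normc_ge0//.
by apply: ge0_ler_powR => //; rewrite ?nnegrE ?(ltW p0) ?addr_ge0 ?normc_ge0.
Qed.

(** The size delta of the perturbation depends on the measure only through the
    bound I on the main term. *)
Lemma int_powp_perturb (I e : R) : 0 <= I -> 0 < e -> exists2 delta : R, 0 < delta &
  forall (mu : {measure set T -> \bar R}) (f g h : T -> R[i]),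
  cmeasurable f -> cmeasurable g -> cmeasurable h ->
  (forall t, normc (h t) <= normc (f t) + normc (g t)) ->
  (int_powp mu p f <= I%:E -> int_powp mu p g <= delta%:E ->
   int_powp mu p h <= (I + e)%:E)%E.
Proof.
move=> I0 e0; pose eta := e / (2 * (I + 1)).
have I1 : 0 < I + 1 by rewrite ltr_wpDl.
have eta0 : 0 < eta by rewrite divr_gt0// mulr_gt0.
have [C C0 leD] := int_powpD_le eta0.
have C1 : 0 < C + 1 by rewrite ltr_wpDl.
exists (e / (2 * (C + 1))); first by rewrite divr_gt0// mulr_gt0.
move=> mu f g h mf mg mh hfg fI gd.
apply: (le_trans (leD mu f g h mf mg mh hfg)).
apply: (@le_trans _ _ ((1 + eta)%:E * I%:E + C%:E * (e / (2 * (C + 1)))%:E)%E).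
  by apply: leeD; apply: lee_wpmul2l => //; rewrite lee_fin ?addr_ge0// ltW.
rewrite -!EFinM -EFinD lee_fin mulrDl mul1r -addrA lerD2l.
rewrite [leRHS](splitr e) lerD//.
  rewrite /eta (_ : _ * I = e / 2 * (I / (I + 1))); last by field; rewrite gt_eqF.
  by rewrite ler_piMr ?divr_ge0 ?(ltW e0)// ler_pdivrMr// mul1r lerDl.
rewrite (_ : C * _ = e / 2 * (C / (C + 1))); last by field; rewrite gt_eqF.
by rewrite ler_piMr ?divr_ge0 ?(ltW e0)// ler_pdivrMr// mul1r lerDl.
Qed.

(** Uniform convexity of L^p around functions of p-th power integral close to I
    whose midpoint does not fall below I. *)
Lemma int_powp_unif_convex (I eta : R) : 0 <= I -> 0 < eta ->
  exists2 delta : R, 0 < delta &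
  forall (mu : {measure set T -> \bar R}) (f g : T -> R[i]),
  cmeasurable f -> cmeasurable g ->
  (int_powp mu p f <= (I + delta)%:E -> int_powp mu p g <= (I + delta)%:E ->
   I%:E <= int_powp mu p (fun t => (f t + g t) / 2)%R ->
   int_powp mu p (f \- g)%R <= eta%:E)%E.
Proof.
move=> I0 eta0; have I1 : 0 < I + 1 by rewrite ltr_wpDl.
pose e := eta / (4 * (I + 1)).
have e0 : 0 < e by rewrite divr_gt0// mulr_gt0.
have [C C0 uc] := normc_powR_unif_convex p1 e0.
have C1 : 0 < C + 1 by rewrite ltr_wpDl.
pose delta := Num.min 1 (eta / (2 * (C + 1))).
have d1 : delta <= 1 by rewrite ge_min lexx.
have d2 : delta <= eta / (2 * (C + 1)) by rewrite ge_min lexx orbT.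
have d0 : 0 < delta by rewrite lt_min ltr01 divr_gt0// mulr_gt0.
exists delta => // mu f g mf mg fI gI mid.
have mm : cmeasurable (fun t => (f t + g t) / 2).
  apply: (@cmeasurableM _ _ _ (fun t => f t + g t) (fun=> 2^-1)).
    exact: cmeasurableD.
  exact: cmeasurable_cst.
have eC0 : 0 <= e + C / 2 by rewrite addr_ge0 ?(ltW e0)// divr_ge0.
have H : (int_powp mu p (f \- g)%R + C%:E * int_powp mu p (fun t => (f t + g t) / 2)%R <=
    (e + C / 2)%:E * int_powp mu p f + (e + C / 2)%:E * int_powp mu p g)%E.
  rewrite -[X in (X + _)%E]mul1e.
  apply: le_int_powp_lin => //; first exact: cmeasurableB.
  by move=> t; rewrite mul1r -mulrDr; exact: uc.
have {}H : (int_powp mu p (f \- g)%R + (C * I)%:E <= ((e + C / 2) * (2 * (I + delta)))%:E)%E.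
  apply: (@le_trans _ _ (int_powp mu p (f \- g)%R +
      C%:E * int_powp mu p (fun t => (f t + g t) / 2)%R)%E).
    by rewrite leeD2l// EFinM lee_wpmul2l.
  apply: (le_trans H).
  rewrite (_ : (e + C / 2) * (2 * (I + delta)) =
    (e + C / 2) * (I + delta) + (e + C / 2) * (I + delta)); last by ring.
  by rewrite [leRHS]EFinD (EFinM _ (I + delta)); apply: leeD; apply: lee_wpmul2l.
rewrite -leeBrDr// -EFinB in H; apply: (le_trans H); rewrite lee_fin.
rewrite (_ : _ - _ = 2 * e * (I + delta) + C * delta); last by field.
rewrite [leRHS](splitr eta) lerD//.
  apply: (@le_trans _ _ (2 * e * (I + 1))).
    by apply: ler_wpM2l; [rewrite mulr_ge0// ltW|rewrite lerD2l].
  by rewrite /e le_eqVlt (_ : _ * _ = eta / 2) ?eqxx//; field; rewrite gt_eqF.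
apply: (@le_trans _ _ (C * (eta / (2 * (C + 1))))); first by rewrite ler_wpM2l.
rewrite (_ : C * _ = eta / 2 * (C / (C + 1))); last by field; rewrite gt_eqF.
by rewrite ler_piMr ?divr_ge0 ?(ltW eta0)// ler_pdivrMr// mul1r lerDl.
Qed.

End perturbation.

(** * Best approximation of 1 from a class of functions stable under truncation *)

(** F stands for T(S); [truncF] is the only property of it that goes beyond being a
    midpoint-convex set of bounded measurable functions containing 0. *)
Section approximation.
Context {d : measure_display} {T : measurableType d} {R : realType}.
Variables (p : R) (p1 : 1 < p) (F : set (T -> R[i])).
Hypotheses (mF : forall f, F f -> cmeasurable f) (F0 : F (cst 0))
  (midF : forall f g, F f -> F g -> F (fun t => (f t + g t) / 2))
  (bdF : forall f, F f -> exists M, forall t, normc (f t) <= M)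
  (truncF : forall f e, F f -> 0 < e ->
    exists2 g, F g & forall t, normc (g t) <= 2 /\
      forall w, normc w <= 1 -> normc (g t - w) <= normc (f t - w) + e).
Implicit Types (mu nu : {finite_measure set T -> \bar R}) (f g phi : T -> R[i]).

Let p0 : 0 < p. Proof. exact: lt_trans ltr01 p1. Qed.

Local Notation dist mu :=
  (ereal_inf [set int_powp mu p (cst 1 \- tau) | tau in F]).
Local Notation err mu f := (int_powp mu p (cst 1 \- f)%R).

Let m1 : cmeasurable (cst (1 : R[i]) : T -> R[i]) := cmeasurable_cst 1.

Lemma int_powp_bounded_lty mu f : cmeasurable f -> (exists M, forall t, normc (f t) <= M) ->
  (int_powp mu p f < +oo)%E.
Proof.
move=> mf [M fM]; apply: le_lt_trans (int_powp_bounded mu (ltW p0) mf fM) _.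
by rewrite ltey_eq fin_numM// fin_num_measure.
Qed.

Lemma dist_ge0 mu : (0 <= dist mu)%E.
Proof. by apply: le_ereal_inf_tmp => _ [f _ <-]; exact: int_powp_ge0. Qed.

Lemma dist_fin mu : dist mu \is a fin_num.
Proof.
rewrite ge0_fin_numE ?dist_ge0//.
apply: (@le_lt_trans _ _ (err mu (cst 0))).
  by apply: ereal_inf_lbound; exists (cst 0).
apply: int_powp_bounded_lty; first by apply: cmeasurableB => //; exact: mF.
exists 1 => t; rewrite (_ : (cst 1 \- cst 0) t = 1); last exact: subr0.
by rewrite ComplexField.Normc.normc1.
Qed.

Lemma dist_le_err mu f : F f -> (dist mu <= err mu f)%E.
Proof. by move=> Ff; apply: ereal_inf_lbound; exists f. Qed.

Lemma LpP mu f : Lp mu p f <-> cmeasurable f /\ (int_powp mu p f < +oo)%E.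
Proof. by split=> [[]|[[]]]. Qed.

Lemma closureF mu f : F f -> Lp_closure mu p F f.
Proof.
move=> Ff; split=> [|e e0].
  by apply/LpP; split; [exact: mF|apply: int_powp_bounded_lty; [exact: mF|exact: bdF]].
exists f => //; rewrite (_ : int_powp _ _ _ = 0%E) ?lte_fin//.
rewrite /int_powp; apply: integral0_eq => t _ /=.
by rewrite subrr ComplexField.Normc.normc0 powR0// gt_eqF.
Qed.

Lemma closure_meas mu f : Lp_closure mu p F f -> cmeasurable f.
Proof. by move=> [/LpP[]]. Qed.

Lemma dist_le_err_closure mu f : Lp_closure mu p F f -> (dist mu <= err mu f)%E.
Proof.
move=> [/LpP[mf _] fcl].
have [fin|] := boolP (err mu f \is a fin_num); last first.
  by rewrite ge0_fin_numE ?int_powp_ge0// -leNgt leye_eq => /eqP ->; rewrite leey.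
apply/lee_addgt0Pr => e e0.
have I0 := fine_ge0 (int_powp_ge0 mu p (cst 1 \- f)).
have [delta delta0 near] := @int_powp_perturb d T R p p1 _ _ I0 e0.
have [g Fg fg] := fcl _ delta0.
apply: (le_trans (dist_le_err mu Fg)).
rewrite -(fineK fin) -EFinD.
apply: (near mu (cst 1 \- f) (f \- g) (cst 1 \- g)).
- exact: cmeasurableB.
- by apply: cmeasurableB => //; exact: mF.
- by apply: cmeasurableB => //; exact: mF.
- by move=> t; exact: normc_tri.
- by rewrite fineK.
- exact: ltW.
Qed.

Lemma closure_mid mu f g : Lp_closure mu p F f -> Lp_closure mu p F g ->
  Lp_closure mu p F (fun t => (f t + g t) / 2).
Proof.
move=> [/LpP[mf finf] fcl] [/LpP[mg fing] gcl].
have half u : cmeasurable u -> cmeasurable (fun t => u t / 2).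
  by move=> mu'; apply: (cmeasurableM mu'); exact: cmeasurable_cst.
have mfg : cmeasurable (fun t => (f t + g t) / 2) by apply: half; exact: cmeasurableD.
have [C C0 combine] := int_powpD_le (T := T) p1 (@ltr01 R).
have half_le (a b : R[i]) : normc ((a + b) / 2) <= normc a + normc b.
  rewrite normc_half ler_pdivrMr//; have := normcD a b.
  by have := normc_ge0 a; have := normc_ge0 b; lra.
split.
  apply/LpP; split; first exact: mfg.
  apply: (le_lt_trans (combine mu f g _ mf mg mfg (fun t => half_le _ _))).
  apply: lte_add_pinfty; apply: lte_mul_pinfty; [|exact: isT|exact: finf| |exact: isT|exact: fing].
    by rewrite lee_fin addr_ge0.
  by rewrite lee_fin.
move=> e e0; pose e' := e / (2 + C + 1).
have C3 : 0 < 2 + C + 1 by lra.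
have e'0 : 0 < e' by rewrite divr_gt0.
have [f' Ff' ff'] := fcl _ e'0; have [g' Fg' gg'] := gcl _ e'0.
exists (fun t => (f' t + g' t) / 2); first exact: midF.
have mff' := cmeasurableB mf (mF Ff'); have mgg' := cmeasurableB mg (mF Fg').
apply: (le_lt_trans (combine mu (f \- f') (g \- g') _ mff' mgg' _ _)).
- by apply: cmeasurableB => //; apply: half; apply: cmeasurableD; exact: mF.
- move=> t /=; rewrite -mulrBl.
  have -> : f t + g t - (f' t + g' t) = (f t - f' t) + (g t - g' t) by ring.
  exact: half_le.
apply: (@le_lt_trans _ _ ((1 + 1)%:E * e'%:E + C%:E * e'%:E)%E).
  apply: leeD; apply: lee_wpmul2l.
  - by rewrite lee_fin addr_ge0.
  - exact: ltW ff'.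
  - by rewrite lee_fin.
  - exact: ltW gg'.
rewrite -!EFinM -EFinD lte_fin -mulrDl.
rewrite [ltRHS](_ : e = (2 + C + 1) * e'); last by rewrite /e' mulrC divfK// gt_eqF.
by rewrite ltr_pM2r//; lra.
Qed.

(** The midpoint of two elements of the closure is again in the closure, so its error
    is at least the distance. *)
Lemma near_minimizers_close mu eta : 0 < eta -> exists2 delta : R, 0 < delta &
  forall f g, Lp_closure mu p F f -> Lp_closure mu p F g ->
  (err mu f <= dist mu + delta%:E -> err mu g <= dist mu + delta%:E ->
   int_powp mu p (f \- g)%R <= eta%:E)%E.
Proof.
move=> eta0.
have [delta delta0 uc] := @int_powp_unif_convex d T R p p1 _ _ (fine_ge0 (dist_ge0 mu)) eta0.
exists delta => // f g clf clg errf errg.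
have mf := closure_meas clf; have mg := closure_meas clg.
have -> : int_powp mu p (f \- g) = int_powp mu p ((cst 1 \- g) \- (cst 1 \- f)).
  by apply: eq_integral => t _; congr ((normc _ `^ _)%:E) => /=; ring.
apply: uc; [exact: cmeasurableB|exact: cmeasurableB| | |].
- by rewrite EFinD (fineK (dist_fin mu)); exact: errg.
- by rewrite EFinD (fineK (dist_fin mu)); exact: errf.
rewrite fineK ?dist_fin//.
apply: (le_trans (dist_le_err_closure (closure_mid clf clg))).
rewrite le_eqVlt; apply/orP; left; apply/eqP; apply: eq_integral => t _ /=.
by congr ((normc _ `^ _)%:E); field.
Qed.

(** Truncate a near-minimizer; the additive error e in the truncation is a constant,
    whose norm in L^p(mu) is small with e because mu is finite. *)
Lemma bounded_near_minimizer mu eta : 0 < eta ->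
  exists f, [/\ F f, forall t, normc (f t) <= 2 & (err mu f <= dist mu + eta%:E)%E].
Proof.
move=> eta0; have eta20 : 0 < eta / 2 by rewrite divr_gt0.
have [_ [f Ff <-] /ltW fD] := lb_ereal_inf_adherent eta20 (dist_fin mu).
have I0 : 0 <= fine (dist mu) + eta / 2 by rewrite addr_ge0 ?fine_ge0 ?dist_ge0// ltW.
have [delta delta0 near] := @int_powp_perturb d T R p p1 _ _ I0 eta20.
pose m := fine (mu setT).
have m0 : 0 < m + 1 by rewrite ltr_wpDl// fine_ge0.
pose e := (delta / (m + 1)) `^ p^-1.
have e0 : 0 < e by apply: powR_gt0; exact: divr_gt0.
have ep : e `^ p = delta / (m + 1).
  by rewrite /e -powRrM mulVf ?gt_eqF// powRr1// divr_ge0// ltW.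
have [g Fg gP] := truncF Ff e0.
exists g; split => //; first by move=> t; have [] := gP t.
have mf := mF Ff; have mg := mF Fg.
rewrite -(fineK (dist_fin mu)) -EFinD [eta](splitr eta) addrA.
apply: (near mu (cst 1 \- f) (cst e%:C%C) (cst 1 \- g)).
- exact: cmeasurableB.
- exact: cmeasurable_cst.
- exact: cmeasurableB.
- move=> t; rewrite -[(cst 1 \- g) t]/(1 - g t) -[(cst 1 \- f) t]/(1 - f t).
  rewrite (_ : normc (cst (e%:C)%C t) = e); last by rewrite /cst normc_real gtr0_norm.
  rewrite normcB_sym (normcB_sym 1).
  by have [_] := gP t; apply; rewrite ComplexField.Normc.normc1.
- by rewrite EFinD fineK ?dist_fin.
- apply: (le_trans (int_powp_bounded mu (ltW p0) (cmeasurable_cst _) (M := e) _)).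
    by move=> t; rewrite /cst normc_real gtr0_norm.
  rewrite ep -[mu setT]fineK ?fin_num_measure// -EFinM lee_fin mulrAC.
  by rewrite ler_pdivrMr// ler_pM2l// lerDl.
Qed.

Lemma err_tv_dist mu nu f : cmeasurable f -> (forall t, normc (f t) <= 2) ->
  (err mu f <= err nu f + (3 `^ p)%:E * tv_dist mu nu /\
   err nu f <= err mu f + (3 `^ p)%:E * tv_dist mu nu)%E.
Proof.
move=> mf f2; apply: le_integral_tv_dist => [|t].
  by apply: measurable_normc_powR; exact: cmeasurableB.
rewrite powR_ge0/=; apply: ge0_ler_powR; rewrite ?nnegrE ?normc_ge0 ?(ltW p0)//.
have := normc_tri 1 0 (f t); rewrite subr0 ComplexField.Normc.normc1 sub0r.
have -> : normc (- f t) = normc (f t) by exact: (@normcN R (f t)).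
by move: (f2 t) => /=; lra.
Qed.

Lemma dist_tv_dist mu nu :
  (dist mu <= dist nu + (3 `^ p)%:E * tv_dist mu nu /\
   dist nu <= dist mu + (3 `^ p)%:E * tv_dist mu nu)%E.
Proof.
split; apply/lee_addgt0Pr => e e0.
- have [f [Ff f2 errf]] := bounded_near_minimizer nu e0.
  apply: (le_trans (dist_le_err mu Ff)); have [h _] := err_tv_dist mu nu (mF Ff) f2.
  by apply: (le_trans h); rewrite [leRHS]addeAC; exact: leeD2r.
- have [f [Ff f2 errf]] := bounded_near_minimizer mu e0.
  apply: (le_trans (dist_le_err nu Ff)); have [_ h] := err_tv_dist mu nu (mF Ff) f2.
  by apply: (le_trans h); rewrite [leRHS]addeAC; exact: leeD2r.
Qed.

Lemma tv_dist_small mu0 (mu : nat -> {finite_measure set T -> \bar R}) (e : R) :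
  tv_dist mu0 (mu n) @[n --> \oo] --> 0%E -> 0 < e ->
  \forall n \near \oo, ((3 `^ p)%:E * tv_dist mu0 (mu n) <= e%:E)%E.
Proof.
move=> /fine_cvgP[fin cvg0] e0; have c0 : 0 < 3 `^ p :> R by exact: powR_gt0.
have /cvgr0_norm_le/(_ _ (divr_gt0 e0 c0)) small := cvg0; near=> n.
have finn : tv_dist mu0 (mu n) \is a fin_num by near: n.
rewrite -(fineK finn) -EFinM lee_fin -ler_pdivlMl// mulrC.
by rewrite (le_trans (ler_norm _))//; near: n.
Unshelve. all: by end_near. Qed.

Lemma dist_cvg mu0 (mu : nat -> {finite_measure set T -> \bar R}) :
  tv_dist mu0 (mu n) @[n --> \oo] --> 0%E ->
  dist (mu n) @[n --> \oo] --> dist mu0.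
Proof.
move=> tv0; rewrite -(fineK (dist_fin mu0)); apply/fine_cvgP; split.
  by apply: nearW => n; exact: dist_fin.
apply/cvgrPdist_le => e e0; near=> n.
have small : ((3 `^ p)%:E * tv_dist mu0 (mu n) <= e%:E)%E.
  by near: n; exact: tv_dist_small.
have [h1 h2] := dist_tv_dist mu0 (mu n).
have {}h1 := le_trans h1 (leeD2l _ small); have {}h2 := le_trans h2 (leeD2l _ small).
rewrite -(fineK (dist_fin mu0)) -(fineK (dist_fin (mu n))) -EFinD lee_fin in h1.
rewrite -(fineK (dist_fin mu0)) -(fineK (dist_fin (mu n))) -EFinD lee_fin in h2.
by rewrite /= ler_norml; apply/andP; split; lra.
Unshelve. all: by end_near. Qed.

(** Take near-minimizers g_k whose tolerances dd k are decreasing, tend to 0, and are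
    so small that the sequence is fast Cauchy by uniform convexity. *)
Lemma exists_projection mu : exists phi, Lp_closure mu p F phi /\ err mu phi = dist mu.
Proof.
pose q k : R := (2^-1 ^+ k) `^ p * 2^-1 ^+ k.
have q0 k : 0 < q k by rewrite mulr_gt0 ?powR_gt0 ?exprn_gt0.
have /choice[delta deltaP] k : exists delta : R, 0 < delta /\
    forall f g, Lp_closure mu p F f -> Lp_closure mu p F g ->
    (err mu f <= dist mu + delta%:E -> err mu g <= dist mu + delta%:E ->
     int_powp mu p (f \- g)%R <= (q k)%:E)%E.
  by have [delta] := near_minimizers_close mu (q0 k); exists delta.
pose fix dd (k : nat) : R :=
  if k is k'.+1 then Num.min (dd k') (Num.min (delta k) (k.+1%:R^-1)) else delta 0%N.
have dd0 k : 0 < dd k.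
  elim: k => [|k IHk]; first exact: (deltaP 0%N).1.
  by rewrite /= !lt_min IHk (deltaP k.+1).1 invr_gt0 ltr0n.
have dd_delta k : dd k <= delta k by case: k => [//|k] /=; rewrite !ge_min lexx orbT.
have dd_dec k : dd k.+1 <= dd k by rewrite /= ge_min lexx.
have /choice[g gP] k := bounded_near_minimizer mu (dd0 k).
have Fg k : F (g k) by case: (gP k).
have gerr k : (err mu (g k) <= dist mu + (dd k)%:E)%E by case: (gP k).
have [|phi mphi cvg_phi] := @bounded_fast_cauchy _ _ _ p p0 2 g
  (fun k => mF (Fg k)) (fun k => let: And3 _ h _ := gP k in h) mu.
  move=> k; apply: (deltaP k).2; [exact: closureF|exact: closureF| |].
    by apply: (le_trans (gerr _)); rewrite leeD2l// lee_fin (le_trans (dd_dec k)).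
  by apply: (le_trans (gerr _)); rewrite leeD2l// lee_fin.
have approx (e : R) : 0 < e -> exists k, (int_powp mu p (g k \- phi)%R < e%:E)%E /\ dd k <= e.
  move=> e0; have := cvg_phi; move=> /fine_cvgP[fin] /cvgr0_norm_lt/(_ _ e0) lt_e.
  have ltinv : \forall k \near \oo, k.+1%:R^-1 < e.
    exact: near_infty_natSinv_lt (PosNum e0).
  have [N _ NP] : \forall k \near \oo, [/\ int_powp mu p (g k \- phi) \is a fin_num,
      `|fine (int_powp mu p (g k \- phi))| < e & k.+1%:R^-1 < e].
    by near=> k; split; near: k.
  have [fink ltk ltinvk] := NP N.+1 (leqnSn N).
  exists N.+1; split.
    by rewrite -(fineK fink) lte_fin (le_lt_trans (ler_norm _)).
  by rewrite /= !ge_min (ltW ltinvk) !orbT.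
have clphi : Lp_closure mu p F phi.
  split.
    apply/LpP; split => //.
    pose I := fine ((2 `^ p)%:E * mu setT)%E.
    have finI : ((2 `^ p)%:E * mu setT)%E \is a fin_num.
      by rewrite fin_numM// fin_num_measure.
    have I0 : 0 <= I by rewrite fine_ge0// mule_ge0// lee_fin powR_ge0.
    have [eta eta0 near] := @int_powp_perturb d T R p p1 _ _ I0 (@ltr01 R).
    have [k [phik _]] := approx eta eta0.
    apply: (@le_lt_trans _ _ (I + 1)%:E); last exact: ltry.
    apply: (near mu (g k) (g k \- phi)) => //.
    + exact: mF.
    + by apply: cmeasurableB => //; exact: mF.
    + move=> t; rewrite -[(g k \- phi) t]/(g k t - phi t) normcB_sym.
      by rewrite (le_trans _ (normcD _ _))// addrC subrK.
    + rewrite (fineK finI); apply: int_powp_bounded; [exact: ltW|exact: mF|].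
      by case: (gP k).
    + exact: ltW.
  move=> e e0; have [k [phik _]] := approx e e0.
  by exists (g k); [exact: Fg|rewrite int_powp_sym; exact: phik].
exists phi; split => //; apply/eqP; rewrite eq_le dist_le_err_closure// andbT.
apply/lee_addgt0Pr => e e0; have e20 : 0 < e / 2 by rewrite divr_gt0.
have I0 : 0 <= fine (dist mu) + e / 2 by rewrite addr_ge0 ?fine_ge0 ?dist_ge0// ltW.
have [eta eta0 near] := @int_powp_perturb d T R p p1 _ _ I0 e20.
have [|k [phik ddk]] := approx (Num.min eta (e / 2)); first by rewrite lt_min eta0.
rewrite le_min in ddk; case/andP: ddk => _ ddk.
rewrite -(fineK (dist_fin mu)) -EFinD [e](splitr e) addrA.
have mg := mF (Fg k).
apply: (near mu (cst 1 \- g k) (g k \- phi) (cst 1 \- phi)).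
- exact: cmeasurableB.
- exact: cmeasurableB.
- exact: cmeasurableB.
- by move=> t; exact: normc_tri.
- rewrite EFinD (fineK (dist_fin mu)); apply: (le_trans (gerr k)).
  by rewrite leeD2l// lee_fin.
- by apply: (le_trans (ltW phik)); rewrite lee_fin ge_min lexx.
Unshelve. all: by end_near. Qed.

(** Absolute continuity carries almost everywhere convergence from nu to mu0, and
    uniform boundedness turns it back into convergence in L^p(mu0). *)
Lemma projection_approx mu0 nu phi (e : R) : mu0 `<< nu ->
  Lp_closure nu p F phi -> err nu phi = dist nu -> 0 < e ->
  exists g, [/\ F g, forall t, normc (g t) <= 2, (err nu g <= dist nu + e%:E)%E &
    (int_powp mu0 p (g \- phi)%R <= e%:E)%E].
Proof.
move=> dom clphi errphi e0.
have q0 k : 0 < 2^-1 ^+ k :> R by rewrite exprn_gt0.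
have /choice[g gP] k : exists g, [/\ F g, forall t, normc (g t) <= 2,
    (err nu g <= dist nu + e%:E)%E & (int_powp nu p (g \- phi)%R <= (2^-1 ^+ k)%:E)%E].
  have [delta delta0 close] := near_minimizers_close nu (q0 k).
  have m0 : 0 < Num.min delta e by rewrite lt_min delta0.
  have [g [Fg g2 errg]] := bounded_near_minimizer nu m0.
  exists g; split => //.
    by apply: (le_trans errg); rewrite leeD2l// lee_fin ge_min lexx orbT.
  apply: close; [exact: closureF|exact: clphi| |].
    by apply: (le_trans errg); rewrite leeD2l// lee_fin ge_min lexx.
  by rewrite errphi leeDl// lee_fin ltW.
have mg k : cmeasurable (g k) by case: (gP k) => /mF.
have mphi := closure_meas clphi.
have [Z [mZ Z0 Zcvg]] := ae_cvg_int_powp (fun k => cmeasurableB (mg k) mphi)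
  (fun k => let: And4 _ _ _ h := gP k in h).
have ae0 : {ae mu0, forall t, normc (g k t - phi t) `^ p @[k --> \oo] --> (0 : R)}.
  exists Z; split => //; move/null_content_dominatesP : dom; exact.
have := @bounded_cvg_int_powp _ _ _ p p0 2 g mg
  (fun k => let: And4 _ h _ _ := gP k in h) mu0 phi mphi ae0.
move=> /fine_cvgP[fin] /cvgr0_norm_lt/(_ _ e0) lt_e.
have [N _ NP] : \forall k \near \oo, int_powp mu0 p (g k \- phi) \is a fin_num /\
    `|fine (int_powp mu0 p (g k \- phi))| < e.
  by near=> k; split; near: k.
have [fink ltk] := NP N (leqnn N).
have [Fg g2 errg _] := gP N; exists (g N); split => //.
by rewrite -(fineK fink) lee_fin (le_trans (ler_norm _))// ltW.
Unshelve. all: by end_near. Qed.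

Lemma projection_cvg mu0 (mu : nat -> {finite_measure set T -> \bar R}) phi0
    (phi : nat -> T -> R[i]) :
  tv_dist mu0 (mu n) @[n --> \oo] --> 0%E -> (forall n, mu0 `<< mu n) ->
  Lp_closure mu0 p F phi0 -> err mu0 phi0 = dist mu0 ->
  (forall n, Lp_closure (mu n) p F (phi n)) ->
  (forall n, err (mu n) (phi n) = dist (mu n)) ->
  int_powp mu0 p (phi0 \- phi n) @[n --> \oo] --> 0%E.
Proof.
move=> tv0 dom cl0 err0 cl errn.
suff small (e : R) : 0 < e ->
    \forall n \near \oo, (int_powp mu0 p (phi0 \- phi n)%R <= e%:E)%E.
  apply/fine_cvgP; split.
    near=> n; rewrite ge0_fin_numE ?int_powp_ge0//.
    apply: (@le_lt_trans _ _ 1%:E); last exact: ltry.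
    by near: n; exact: small.
  apply/cvgr0Pnorm_le => e e0; near=> n.
  have le_e : (int_powp mu0 p (phi0 \- phi n)%R <= e%:E)%E by near: n; exact: small.
  rewrite /= ger0_norm ?fine_ge0 ?int_powp_ge0// -lee_fin fineK//.
  by rewrite ge0_fin_numE ?int_powp_ge0// (le_lt_trans le_e)// ltry.
move=> e0; have e20 : 0 < e / 2 by rewrite divr_gt0.
have [eta eta0 near] := @int_powp_perturb d T R p p1 _ _ (ltW e20) e20.
have [delta delta0 close] := near_minimizers_close mu0 e20.
(* Three error terms: g is a near-minimizer for mu n; changing the measure in the
   error of g; changing the measure in the distance. *)
have d30 : 0 < delta / 3 by rewrite divr_gt0.
near=> n.
have small : ((3 `^ p)%:E * tv_dist mu0 (mu n) <= (delta / 3)%:E)%E.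
  by near: n; exact: tv_dist_small.
have m0 : 0 < Num.min eta (delta / 3) by rewrite lt_min eta0.
have [g [Fg g2 errg gphi]] := projection_approx (dom n) (cl n) (errn n) m0.
have err0g : (err mu0 g <= dist mu0 + delta%:E)%E.
  have [h1 _] := err_tv_dist mu0 (mu n) (mF Fg) g2.
  have [_ h2] := dist_tv_dist mu0 (mu n).
  apply: (le_trans h1); apply: (le_trans (leeD errg small)).
  apply: (@le_trans _ _ (dist mu0 + (delta / 3)%:E + (delta / 3)%:E + (delta / 3)%:E)%E).
    rewrite leeD2r//; apply: leeD; last by rewrite lee_fin ge_min lexx orbT.
    by apply: (le_trans h2); rewrite leeD2l.
  rewrite -!addeA -!EFinD leeD2l// lee_fin; lra.
have h : (int_powp mu0 p (phi0 \- g)%R <= (e / 2)%:E)%E.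
  apply: close; [exact: cl0|exact: closureF| |exact: err0g].
  by rewrite err0 leeDl// lee_fin ltW.
have mphi0 := closure_meas cl0; have mphi := closure_meas (cl n).
rewrite [e in leRHS](splitr e).
apply: (near mu0 (phi0 \- g) (g \- phi n)).
- by apply: cmeasurableB => //; exact: mF.
- by apply: cmeasurableB => //; exact: mF.
- exact: cmeasurableB.
- by move=> t; exact: normc_tri.
- exact: h.
- by apply: (le_trans gphi); rewrite lee_fin ge_min lexx.
Unshelve. all: by end_near. Qed.

End approximation.

(** * Trigonometric polynomials on the dual group *)

Section characters.
Variables (R : realType) (G : topologicalZmodType).
Implicit Types (x y : G) (gamma : borel_dual R G) (S : set G).

Lemma e_D x y gamma : e_ (x + y) gamma = e_ x gamma * e_ y gamma.
Proof. by have [_ _ h] := dualP (gamma : dual R G); exact: h. Qed.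

Lemma norm_e_ x gamma : `|e_ x gamma| = 1.
Proof. by have [_ h _] := dualP (gamma : dual R G); exact: h. Qed.

Lemma normc_e_ x gamma : normc (e_ x gamma) = 1.
Proof.
by have := norm_e_ x gamma; case: (e_ x gamma) => a b; rewrite normc_def => -[].
Qed.

Lemma e_neq0 x gamma : e_ x gamma != 0.
Proof. by rewrite -normr_eq0 norm_e_ oner_eq0. Qed.

Lemma e_0 gamma : e_ 0 gamma = 1.
Proof. by apply: (mulfI (e_neq0 0 gamma)); rewrite -e_D addr0 mulr1. Qed.

Lemma e_N x gamma : e_ (- x) gamma = ((e_ x gamma)^*)%C.
Proof.
have e1 : e_ x gamma * e_ (- x) gamma = 1 by rewrite -e_D subrr e_0.
have e2 : e_ x gamma * ((e_ x gamma)^*)%C = 1 by rewrite -sqr_normc norm_e_ expr1n.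
by apply: (mulfI (e_neq0 x gamma)); rewrite e1 e2.
Qed.

(** Singletons are compact, so evaluation at a point is continuous in the
    compact-open topology. *)
Lemma open_e_preimage x (U : set R[i]) : open U ->
  open [set gamma : dual R G | U (\val gamma x)].
Proof.
move=> oU; exists [set f : {compact-open, G -> R[i]} | f @` [set x] `<=` U].
  by apply: compact_open_open => //; exact: compact_set1.
apply/seteqP; split => gamma /=; first by apply; exists x.
by move=> Ux _ [_ -> <-].
Qed.

Lemma measurable_e (part : R[i] -> R) x :
  (forall z w, part (z - w) = part z - part w) ->
  (forall z, `|part z| <= normc z) ->
  measurable_fun setT (part \o (e_ x : borel_dual R G -> R[i])).
Proof.
move=> partB le_part; apply: (measurability _ (RGenOInfty.measurableE R)).
move=> _ [_ [y ->] <-]; rewrite setTI; apply: sub_sigma_algebra.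
rewrite (_ : _ @^-1` _ = [set gamma : dual R G | [set z | y < part z] (\val gamma x)]).
  apply: open_e_preimage; rewrite openE => z /= yz.
  apply/nbhs_ballP; exists ((part z - y)%:C%C); first by rewrite /= ltcR subr_gt0.
  move=> w; rewrite -ball_normE /= normc_def ltcR => zw.
  have := le_part (z - w); rewrite partB => h.
  have {}zw : normc (z - w) < part z - y by move: zw; case: (z - w).
  by have := ler_norm (part z - part w); lra.
by apply/seteqP; split => gamma /=; rewrite in_itv/= andbT.
Qed.

Lemma cmeasurable_e x : cmeasurable (e_ x : borel_dual R G -> R[i]).
Proof.
split; apply: measurable_e.
- by move=> z w; rewrite raddfB.
- exact: le_Re_normc.
- by move=> z w; rewrite raddfB.
- exact: le_Im_normc.
Qed.

Local Notation tp := (@trig_poly R G).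

Lemma trig_poly_term S (a : R[i]) x : S x -> tp S (fun gamma => a * e_ x gamma).
Proof.
move=> Sx; exists 1%N, (fun=> a), (fun=> x); split => //.
by apply/funext => gamma; rewrite big_ord1.
Qed.

Lemma trig_poly0 S : tp S (cst 0).
Proof.
exists 0%N, (fun=> 0), (fun=> 0); split; first by case.
by apply/funext => gamma; rewrite big_ord0.
Qed.

Lemma trig_polyD S f g : tp S f -> tp S g -> tp S (fun gamma => f gamma + g gamma).
Proof.
move=> [n [a [u [Su ->]]]] [m [b [v [Sv ->]]]].
exists (n + m)%N, (fun j => match fintype.split j with inl i => a i | inr i => b i end),
  (fun j => match fintype.split j with inl i => u i | inr i => v i end); split.
  by move=> j; case: fintype.split.
apply/funext => gamma; rewrite big_split_ord/=; congr (_ + _);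
  apply: eq_bigr => i _.
  by rewrite -[lshift m i]/(unsplit (inl i)) unsplitK.
by rewrite -[rshift n i]/(unsplit (inr i)) unsplitK.
Qed.

Lemma trig_poly_sum S n (f : 'I_n -> borel_dual R G -> R[i]) :
  (forall j, tp S (f j)) -> tp S (fun gamma => \sum_(j < n) f j gamma).
Proof.
elim: n f => [|n IHn] f tpf.
  by under eq_fun do rewrite big_ord0; exact: trig_poly0.
under eq_fun do rewrite big_ord_recr.
by apply: trig_polyD => //; exact: IHn.
Qed.

Lemma trig_polyM S1 S2 S f g : (forall s t, S1 s -> S2 t -> S (s + t)) ->
  tp S1 f -> tp S2 g -> tp S (fun gamma => f gamma * g gamma).
Proof.
move=> S12 [n [a [u [Su ->]]]] [m [b [v [Sv ->]]]].
under eq_fun do rewrite big_distrlr.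
apply: trig_poly_sum => i; apply: trig_poly_sum => j.
rewrite (_ : (fun gamma => _) = fun gamma => a i * b j * e_ (u i + v j) gamma).
  by apply: trig_poly_term; exact: S12.
by apply/funext => gamma; rewrite e_D mulrACA.
Qed.

Lemma trig_poly_conj S f : tp S f -> tp [set - s | s in S] (fun gamma => ((f gamma)^*)%C).
Proof.
move=> [n [a [u [Su ->]]]]; exists n, (fun j => ((a j)^*)%C), (fun j => - u j).
split=> [j|]; first by exists (u j).
apply/funext => gamma; rewrite (raddf_sum (@conjc R)); apply: eq_bigr => j _.
by rewrite e_N; exact: rmorphM.
Qed.

Lemma trig_poly_cst S (c : R[i]) : S 0 -> tp S (fun=> c).
Proof.
move=> S0; rewrite (_ : (fun=> c) = fun gamma => c * e_ 0 gamma).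
  exact: trig_poly_term.
by apply/funext => gamma; rewrite e_0 mulr1.
Qed.

Lemma trig_poly_mid S f g : tp S f -> tp S g ->
  tp S (fun gamma => (f gamma + g gamma) / 2).
Proof.
move=> Sf Sg; apply: (@trig_polyM S [set 0] S (fun gamma => f gamma + g gamma) (fun=> 2^-1)).
- by move=> s _ Ss ->; rewrite addr0.
- exact: trig_polyD.
- exact: trig_poly_cst.
Qed.

Lemma trig_poly_bounded S f : tp S f -> exists M, forall gamma, normc (f gamma) <= M.
Proof.
move=> [n [a [u [_ ->]]]]; exists (\sum_(j < n) normc (a j)) => gamma.
elim/big_ind2 : _ => [|z M w N zM wN|j _].
- by rewrite ComplexField.Normc.normc0.
- by rewrite (le_trans (normcD _ _))// lerD.
- by rewrite ComplexField.Normc.normcM normc_e_ mulr1.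
Qed.

Lemma trig_poly_measurable S f : tp S f -> cmeasurable f.
Proof.
move=> [n [a [u [_ ->]]]]; elim: n a u => [|n IHn] a u.
  by under eq_fun do rewrite big_ord0; exact: cmeasurable_cst.
under eq_fun do rewrite big_ord_recr.
apply: cmeasurableD; first exact: IHn.
by apply: cmeasurableM; [exact: cmeasurable_cst|exact: cmeasurable_e].
Qed.

(** For f in T(x + H), |f|^2 = f f^* has its frequencies in H because the two shifts
    by x cancel. *)
Lemma trig_poly_coset_trunc (H S : set G) x f e : zmod_closed [in H] ->
  S = [set x + h | h in H] -> tp S f -> 0 < e ->
  exists2 g, tp S g & forall gamma, normc (g gamma) <= 2 /\
    forall w, normc w <= 1 -> normc (g gamma - w) <= normc (f gamma - w) + e.
Proof.
move=> [/set_mem H0 HB] -> Sf e0; have [M fM] := trig_poly_bounded Sf.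
have HD u v : H u -> H v -> H (u + v).
  move=> /mem_set Hu /mem_set Hv; apply/set_mem; rewrite -[v]opprK.
  by apply: (HB _ _ Hu); rewrite -sub0r; apply: HB => //; exact: mem_set.
apply: (@disc_retract_dense _ _ (tp H)) Sf fM e0.
- by move=> c; exact: trig_poly_cst.
- by move=> a b; exact: trig_polyD.
- by move=> a b; exact: trig_polyM.
- move=> a b; apply: trig_polyM => _ t [h Hh <-] Ht.
  by exists (h + t); [exact: HD|rewrite addrA].
- move=> a Sa; rewrite (_ : (fun gamma => _) = fun gamma => a gamma * ((a gamma)^*)%C).
    apply: (trig_polyM _ Sa (trig_poly_conj Sa)) => _ _ [h Hh <-] [_ [k Hk <-] <-].
    rewrite opprD addrACA subrr add0r; apply/set_mem; apply: HB; exact: mem_set.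
  apply/funext => gamma; rewrite -sqr_normc normc_def -rmorphXn/=.
  by case: (a gamma).
Qed.

End characters.

Theorem theorem7p8 (R : realType) (G : topologicalZmodType)
    (hG : hausdorff_space G) (lcG : locally_compact [set: G])
    (H : set G) (closedH : closed H) (subgroupH : zmod_closed [in H])
    (countableA : countable (annihilator R H))
    (x : G) (xH : ~ H x) (S : set G) (defS : S = [set x + h | h in H])
    (mu0 : {finite_measure set (borel_dual R G) -> \bar R})
    (mu : nat -> {finite_measure set (borel_dual R G) -> \bar R})
    (mu0M : calM mu0) (muM : forall n, calM (mu n))
    (mu_cvg : tv_dist mu0 (mu n) @[n --> \oo] --> 0%E) :
  [/\ dist_p (mu n) 2 S @[n --> \oo] --> dist_p mu0 2 S,
      (annihilator R H #= `I_2)%card -> forall p : R, 1 < p ->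
        dist_p (mu n) p S @[n --> \oo] --> dist_p mu0 p S,
      (forall n, mu0 `<< mu n) ->
        int_powp mu0 2 (metric_projection mu0 2 S \- metric_projection (mu n) 2 S)
          @[n --> \oo] --> 0%E &
      (annihilator R H #= `I_2)%card -> (forall n, mu0 `<< mu n) ->
        forall p : R, 1 < p ->
        int_powp mu0 p (metric_projection mu0 p S \- metric_projection (mu n) p S)
          @[n --> \oo] --> 0%E].
Proof.
have mS := @trig_poly_measurable R G S.
have midS := @trig_poly_mid R G S.
have bdS := @trig_poly_bounded R G S.
have truncS f e := @trig_poly_coset_trunc R G H S x f e subgroupH defS.
have dist_p_cvg (p : R) : 1 < p ->
    dist_p (mu n) p S @[n --> \oo] --> dist_p mu0 p S.
  by move=> p1; apply: (dist_cvg p1 mS (@trig_poly0 R G S)) => // f e; exact: truncS.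
have proj_cvg (p : R) : (forall n, mu0 `<< mu n) -> 1 < p ->
    int_powp mu0 p (metric_projection mu0 p S \- metric_projection (mu n) p S)
      @[n --> \oo] --> 0%E.
  move=> dom p1.
  have projP (nu : {finite_measure set (borel_dual R G) -> \bar R}) :
      Lp_closure nu p (trig_poly S) (metric_projection nu p S) /\
      int_powp nu p (cst 1 \- metric_projection nu p S) = dist_p nu p S.
    have ex : exists phi, [set phi | Lp_closure nu p (trig_poly S) phi /\
        int_powp nu p (cst 1 \- phi) = dist_p nu p S] phi.
      exact: (exists_projection p1 mS (@trig_poly0 R G S) midS bdS (truncS)).
    exact: (getPex ex).
  apply: (projection_cvg p1 mS (@trig_poly0 R G S) midS bdS truncS mu_cvg dom).
  - by case: (projP mu0).
  - by case: (projP mu0).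
  - by move=> n; case: (projP (mu n)).
  - by move=> n; case: (projP (mu n)).
have two1 : (1 : R) < 2 by rewrite ltr1n.
split.
- exact: dist_p_cvg.
- by move=> _; exact: dist_p_cvg.
- by move=> dom; exact: proj_cvg.
- by move=> _ dom p p1; exact: proj_cvg.
Qed.
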